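(* Let $\mathbb{E}$ be a complex Hilbert space with orthonormal basis $(e_n)_{n\ge 1}$, and let $(\mathbb{T},D(\mathbb{T}))$ be an unbounded, densely defined, linear, chaotic shift operator on $\mathbb{E}$ whose adjoint satisfies $$\mathbb{T}^{*}e_n=\omega_n e_{n+1},\qquad n\ge 1,$$ where $\omega_n>0$ for all $n\geq 1$. Assume: (Hyp1) $\displaystyle\sum_{n=1}^{\infty}\frac{1}{\omega_n}<\infty$; (Hyp2) $\omega_{n-1}\,\omega_{n+1}\le \omega_n^{2}$ for all $n\ge 2$; (Hyp3) there exist $\alpha>0$, $\beta>0$, $a>0$ and a sequence of (nonzero real) numbers $(\gamma_n)_{n\ge1}$ such that (1) $\displaystyle\frac{\omega_n\gamma_n}{\gamma_{n+1}}\ge n^{1+\alpha}$, (2) $\displaystyle\frac{\omega_{n-1}\gamma_{n+1}}{\omega_n\gamma_{n-1}}=1-\frac{a}{n}+O\!\left(\frac{1}{n^{1+\beta}}\right)$, (3) $\displaystyle\sum_{n=1}^{\infty}\frac{1}{\gamma_n^{2}}<\infty$. For $\lambda\in\mathbb{C}$ consider the recurrence $$u_1(\lambda)=1,\qquad u_2(\lambda)=\frac{\lambda}{\omega_1},\qquad \omega_{n-1}u_{n-1}(\lambda)+\omega_n u_{n+1}(\lambda)=\lambda u_n(\lambda)\quad (n\ge 2).$$ Then: (i) the recurrence is solvable for every $\lambda\in\mathbb{C}$; (ii) $\displaystyle\sum_{n=1}^{\infty}|u_n(\lambda)|^{2}<\infty$ for every $\lambda\in\mathbb{C}$; (iii)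 the spectrum of $\mathbb{T}+\mathbb{T}^{*}$ is the whole complex plane $\mathbb{C}$; (iv) $(\mathbb{T}+\mathbb{T}^{*})^{m}$ is closed for every $m\in\mathbb{N}$; (v) $\mathbb{T}+\mathbb{T}^{*}$ is a hypercyclic operator; (vi) $\mathbb{T}+\mathbb{T}^{*}$ is a chaotic operator.
   Context: Domains: an operator $\mathbb{A}$ on $\mathbb{X}$ given by a formal action carries the domain $D(\mathbb{A})=\{\phi\in\mathbb{X}:\mathbb{A}\phi\in\mathbb{X}\}$. Powers have their natural domains $D(\mathbb{A}^{m})=\{\phi\in D(\mathbb{A}):\mathbb{A}\phi\in D(\mathbb{A}^{m-1})\}$, and $D(\mathbb{A}^{\infty})=\bigcap_{n\ge 0}D(\mathbb{A}^{n})$. Here $\mathbb{T}$ is the backward shift $\mathbb{T}e_1=0$, $\mathbb{T}e_n=\omega_{n-1}e_{n-1}$ for $n\ge2$, and $\mathbb{T}+\mathbb{T}^{*}$ acts formally on $\phi=\sum_{n\ge1}a_ne_n$ by $$(\mathbb{T}+\mathbb{T}^{*})\phi=\sum_{n\ge 1}(\omega_n a_{n+1}+\omega_{n-1}a_{n-1})e_n\qquad(\text{with }\omega_0a_0:=0),$$ with domain the set of $\phi\in\mathbb{E}$ for which the coefficient sequence on the right is square-summable. Hypercyclic: a linear operator $\mathbb{A}$ on $\mathbb{X}$ is hypercyclic if there is $\phi\in D(\mathbb{A}^{\infty})$ whose orbit $\{\phi,\mathbb{A}\phi,\mathbb{A}^{2}\phi,\dots\}$ is dense in $\mathbb{X}$.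 Chaotic: a linear, unbounded, densely defined operator $\mathbb{A}$ on a Banach space $\mathbb{X}$ is chaotic if (1) $\mathbb{A}^{n}$ is closed for every positive integer $n$; (2) $\mathbb{A}$ is hypercyclic; (3) the set of periodic points $\{\phi\in\mathbb{X}:\exists\, m\ge 1,\ \phi\in D(\mathbb{A}^{m}),\ \mathbb{A}^{m}\phi=\phi\}$ is dense in $\mathbb{X}$. *)

(* Defs.v *)
From HB Require Import structures.
From mathcomp Require Import all_boot all_order all_algebra.
From mathcomp Require Import sesquilinear.
From mathcomp Require Import all_classical all_reals all_analysis.
From mathcomp Require Import complex.

Set Implicit Arguments.
Unset Strict Implicit.
Unset Printing Implicit Defensive.

Import Order.TTheory GRing.Theory Num.Theory.
Import numFieldNormedType.Exports.

Local Open Scope classical_set_scope.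
Local Open Scope complex_scope.
Local Open Scope ring_scope.

(* Sequences (e_n), (w_n), (a_n), ... are indexed by n >= 1, as in the usual
   notation for Jacobi matrices: the value at index 0 of a function out of nat
   is never constrained and never used. *)

(* A possibly unbounded operator.  The values of op_fun outside dom carry no
   meaning; every notion below only looks at op_fun on dom. *)
Record operator (E : Type) := Operator {
  dom : set E;
  op_fun :> E -> E
}.

Definition same_operator (E : Type) (A B : operator E) : Prop :=
  dom A = dom B /\ (forall x, dom A x -> A x = B x).

Fixpoint op_pow (E : Type) (A : operator E) (m : nat) : operator E :=
  if m is m'.+1 then
    Operator [set x | dom A x /\ dom (op_pow A m') (A x)]
             (fun x => op_pow A m' (A x))
  else Operator setT id.

Definition dom_infty (E : Type) (A : operator E) : set E :=
  \bigcap_(n : nat) dom (op_pow A n).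

Definition linear_operator (K : numFieldType) (E : lmodType K)
    (A : operator E) : Prop :=
  dom A 0 /\
  forall (c : K) (x y : E), dom A x -> dom A y ->
    dom A (c *: x + y) /\ A (c *: x + y) = c *: A x + A y.

Definition densely_defined (K : numFieldType) (E : normedModType K)
    (A : operator E) : Prop := dense (dom A).

Definition bounded_operator (R : realType) (E : normedModType R[i])
    (A : operator E) : Prop :=
  exists M : R, forall x, dom A x -> `|A x| <= M%:C * `|x|.

Definition op_graph (E : Type) (A : operator E) : set (E * E) :=
  [set p | dom A p.1 /\ p.2 = A p.1].

Definition closed_operator (K : numFieldType) (E : normedModType K)
    (A : operator E) : Prop := closed (op_graph A).

Definition resolvent_set (R : realType) (E : normedModType R[i])
    (A : operator E) : set R[i] :=
  [set z | (forall y, exists! x, dom A x /\ A x - z *: x = y) /\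
           (exists M : R, forall x, dom A x ->
              `|x| <= M%:C * `|A x - z *: x|)].

Definition spectrum (R : realType) (E : normedModType R[i])
    (A : operator E) : set R[i] := ~` resolvent_set A.

Definition hypercyclic (K : numFieldType) (E : normedModType K)
    (A : operator E) : Prop :=
  exists2 x, dom_infty A x & dense [set op_pow A n x | n in [set: nat]].

Definition periodic_points (E : Type) (A : operator E) : set E :=
  [set x | exists m, [/\ (1 <= m)%N, dom (op_pow A m) x & op_pow A m x = x]].

Definition chaotic (R : realType) (E : completeNormedModType R[i])
    (A : operator E) : Prop :=
  [/\ linear_operator A, ~ bounded_operator A & densely_defined A] /\
  [/\ forall n, (1 <= n)%N -> closed_operator (op_pow A n),
      hypercyclic A &
      dense (periodic_points A)].

Definition square_summable (R : realType) (c : nat -> R[i]) : Prop :=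
  (\sum_(1 <= n <oo) ((Normc.normc (c n)) ^+ 2)%:E < +oo)%E.

(* A complex Hilbert space is a complete normed space over R[i] whose norm
   comes from a positive definite Hermitian form, linear on the left. *)
Definition hilbert_norm (R : realType) (E : completeNormedModType R[i])
    (inner : {dot E for Num.conj}) : Prop :=
  forall x : E, `|x| ^+ 2 = inner x x.

Definition orthonormal_basis (R : realType) (E : completeNormedModType R[i])
    (inner : {dot E for Num.conj}) (e : nat -> E) : Prop :=
  (forall m n, (1 <= m)%N -> (1 <= n)%N -> inner (e m) (e n) = (m == n)%:R) /\
  dense [set x | exists (N : nat) (c : nat -> R[i]),
           x = \sum_(1 <= n < N) c n *: e n].

(* If A is densely defined, the vector y in the definition is unique. *)
Definition adjoint (R : realType) (E : completeNormedModType R[i])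
    (inner : {dot E for Num.conj}) (A : operator E) : operator E :=
  let adj z := [set y | forall x, dom A x -> inner (A x) z = inner x y] in
  Operator [set z | adj z !=set0] (fun z => get (adj z)).

(* The operator acting formally on phi = \sum_(n >= 1) a_n e_n by
   phi |-> \sum_(n >= 1) (F a)_n e_n, on the domain of all phi for which
   the right-hand side belongs to the space. *)
Definition formal_operator (R : realType) (E : completeNormedModType R[i])
    (inner : {dot E for Num.conj}) (e : nat -> E)
    (F : (nat -> R[i]) -> nat -> R[i]) : operator E :=
  let coef phi := fun n => inner phi (e n) in
  Operator [set phi | square_summable (F (coef phi))]
           (fun phi => limn (fun N => \sum_(1 <= n < N) F (coef phi) n *: e n)).

(* T e_1 = 0 and T e_n = w_(n-1) e_(n-1) for n >= 2 *)
Definition backward_shift (R : realType) (E : completeNormedModType R[i])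
    (inner : {dot E for Num.conj}) (e : nat -> E) (w : nat -> R) : operator E :=
  formal_operator inner e (fun a n => (w n)%:C * a n.+1).

(* T + T^*, with the convention w_0 a_0 := 0 *)
Definition shift_plus_adjoint (R : realType) (E : completeNormedModType R[i])
    (inner : {dot E for Num.conj}) (e : nat -> E) (w : nat -> R) : operator E :=
  formal_operator inner e (fun a n =>
    (w n)%:C * a n.+1 + (if n == 1%N then 0 else (w n.-1)%:C * a n.-1)).

Definition solves_recurrence (R : realType) (w : nat -> R) (z : R[i])
    (u : nat -> R[i]) : Prop :=
  [/\ u 1%N = 1,
      u 2%N = z / (w 1%N)%:C &
      forall n, (2 <= n)%N ->
        (w n.-1)%:C * u n.-1 + (w n)%:C * u n.+1 = z * u n].

(* Main.v *)
(** The weights [sqrt (w n)] turn log-concavity into a Gronwall estimate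
    (Berezanskii): if the formal Jacobi expression [F a] is square-summable, so
    is [a], with no condition at infinity.  Hence every [z] is an eigenvalue,
    and [dom (H^m)] is just the set of vectors with [F^m a] square-summable, so
    that [H^m] is closed by continuity of the coordinates.

    The solution operator [S] of [F (S y) = y], [(S y)_1 = 0], is of Volterra
    type, hence quasinilpotent.  Let [p] solve [F p = 0].  The vectors [S^j p]
    span a dense space of generalized eigenvectors for [0]: adding a rank-one
    term to [S] gives a symmetric operator [G], and on the orthogonal complement
    of the [S^j p] this [G] is at the same time adjoint to [S], so symmetric and
    quasinilpotent, so zero; but [F (G f) = f].

    If [F^L y = 0], then [\sum_k S^(k L) y] is a periodic point, close to [y]
    for large [L].  If [y_k] runs through a dense sequence of such vectors
    and [n_k] grows fast, then [\sum_k S^(n_k) y_k] is a hypercyclic vector. *)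
Require Import Defs.
From HB Require Import structures.
From mathcomp Require Import all_boot all_order all_algebra.
From mathcomp Require Import sesquilinear.
From mathcomp Require Import all_classical all_reals all_analysis.
From mathcomp Require Import complex.
From mathcomp Require Import ring lra zify.

Set Implicit Arguments.
Unset Strict Implicit.
Unset Printing Implicit Defensive.

Import Order.TTheory GRing.Theory Num.Theory.
Import numFieldNormedType.Exports.

Local Open Scope classical_set_scope.
Local Open Scope complex_scope.
Local Open Scope ring_scope.

Local Notation nc := Normc.normc.

(** * Modulus of complex numbers *)

Section ComplexModulus.
Variable R : realType.
Implicit Types x y : R[i].

Lemma normc_ge0 x : 0 <= nc x.
Proof. by case: x => a b /=; rewrite sqrtr_ge0. Qed.

Lemma normr_normc x : `|x| = (nc x)%:C.
Proof. by []. Qed.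

Lemma normc_real (a : R) : 0 <= a -> nc a%:C = a.
Proof. by move=> a0; rewrite /= expr0n addr0 sqrtr_sqr ger0_norm. Qed.

Lemma normc_le (a b : R) : nc (a +i* b) <= `|a| + `|b|.
Proof.
rewrite -(@ler_pXn2r _ 2) ?nnegrE ?normc_ge0 ?addr_ge0 //.
rewrite sqr_sqrtr ?addr_ge0 ?sqr_ge0 // sqrrD !real_normK ?num_real //.
by rewrite addrAC lerDl mulrn_wge0 ?mulr_ge0.
Qed.

End ComplexModulus.

(** * Algebra of the formal Jacobi expression: solutions, Green's formula, Wronskians *)

Section Jacobi.
Variable R : realType.
Implicit Types (v : nat -> R) (a b x y : nat -> R[i]).

(* Indices are shifted to start at 0: the paper's omega_n is v (n - 1). *)
Definition jacobi v a n : R[i] :=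
  (v n)%:C * a n.+1 + (if n is m.+1 then (v m)%:C * a m else 0).

(** Forward solution of [jacobi v a n = z * a n + y n] with [a 0 = a0]: equation [m] is solved for
    the coefficient of index [m.+1]. *)
Fixpoint jsol v (z : R[i]) y (a0 : R[i]) n : R[i] :=
  if n is m.+1 then
    (z * jsol v z y a0 m + y m
     - (if m is k.+1 then (v k)%:C * jsol v z y a0 k else 0)) / (v m)%:C
  else a0.

Definition l2 a := exists M : R, forall n, \sum_(k < n) nc (a k) ^+ 2 <= M.

(** [M] bounds the square of the norm, so a norm bound [M] reads [l2le (M ^+ 2)]. *)
Definition l2le (M : R) a := forall n, \sum_(k < n) nc (a k) ^+ 2 <= M.

Lemma jacobi_jsol v z y (a0 : R[i]) : (forall n, 0 < v n) ->
  forall n, jacobi v (jsol v z y a0) n = z * jsol v z y a0 n + y n.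
Proof.
move=> v0 n; have vn : (v n)%:C != 0 :> R[i] by rewrite (inj_eq (@complexI R)) gt_eqF.
by rewrite /jacobi /= mulrC divfK // subrK.
Qed.

(** As [v n] is nonzero, equation [n] determines the coefficient of index [n.+1] from the two before
    it; the induction therefore carries two consecutive indices. *)
Lemma jacobi_inj v (z : R[i]) y a b : (forall n, 0 < v n) -> a 0%N = b 0%N ->
  (forall n, jacobi v a n = z * a n + y n) ->
  (forall n, jacobi v b n = z * b n + y n) -> a = b.
Proof.
move=> v0 ab0 ha hb; apply/funext => n.
suff /(_ n)[] : forall n, a n = b n /\ a n.+1 = b n.+1 by [].
have step m : a m = b m -> (if m is k.+1 then a k = b k else True) ->
    a m.+1 = b m.+1.
  move=> abm abm'; have vm : (v m)%:C != 0 :> R[i] by rewrite (inj_eq (@complexI R)) gt_eqF.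
  apply: (mulfI vm); have := ha m; rewrite abm -hb /jacobi.
  by case: m abm' {abm vm} => [_|k ->]; rewrite ?addr0 // => /addIr.
elim=> [|k [IH1 IH2]]; first by split => //; apply: step.
by split => //; apply: step.
Qed.

Lemma jacobi_lin v (c : R[i]) a b n :
  jacobi v (fun k => c * a k + b k) n = c * jacobi v a n + jacobi v b n.
Proof. by rewrite /jacobi; case: n => [|n]; ring. Qed.

Lemma iter_jacobi_lin v m (c : R[i]) a b n :
  iter m (jacobi v) (fun k => c * a k + b k) n =
  c * iter m (jacobi v) a n + iter m (jacobi v) b n.
Proof.
elim: m n => [//|m IH] n; rewrite !iterS -jacobi_lin; congr jacobi.
by apply/funext => k; rewrite IH.
Qed.

(** Discrete Green formula: the sum telescopes, and only the Wronskian at the upper end survives. *)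
Lemma jacobi_green v a b N :
  \sum_(n < N.+1) (a n * jacobi v b n - jacobi v a n * b n) =
  (v N)%:C * (a N * b N.+1 - a N.+1 * b N).
Proof.
elim: N => [|N IH]; first by rewrite big_ord_recr big_ord0 /= /jacobi; ring.
by rewrite big_ord_recr /= IH /jacobi; ring.
Qed.

(* Plücker's relation between the six Wronskians of x, y and the two solutions
   p, q of the homogeneous recurrence. *)
Lemma jacobi_plucker v p q a b N :
  p 0%N = 1 -> q 0%N = 0 -> a 0%N = 0 -> b 0%N = 0 ->
  (forall n, jacobi v p n = 0) -> (forall n, jacobi v q n = (n == 0%N)%:R) ->
  \sum_(n < N) a n * jacobi v b n - \sum_(n < N) jacobi v a n * b n =
  (\sum_(n < N) jacobi v a n * p n) * (\sum_(n < N) jacobi v b n * q n) -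
  (\sum_(n < N) jacobi v a n * q n) * (\sum_(n < N) jacobi v b n * p n).
Proof.
move=> p0 q0 a0 b0 hp hq.
case: N => [|N]; first by rewrite !big_ord0; ring.
have Wp x : \sum_(n < N.+1) jacobi v x n * p n =
    - ((v N)%:C * (x N * p N.+1 - x N.+1 * p N)).
  rewrite -jacobi_green -sumrN; apply: eq_bigr => n _; rewrite hp; ring.
have Wq x : x 0%N = 0 -> \sum_(n < N.+1) jacobi v x n * q n =
    - ((v N)%:C * (x N * q N.+1 - x N.+1 * q N)).
  move=> x0; rewrite -jacobi_green -sumrN; apply: eq_bigr => -[[|n] ltn] _ /=.
    by rewrite x0; ring.
  by rewrite hq /=; ring.
(* The Wronskian of [p] and [q] is constantly 1, the only contribution coming from equation 0.
   Inserting it on the left makes both sides homogeneous of the same degree, and [ring] applies. *)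
have Wpq : (v N)%:C * (p N * q N.+1 - p N.+1 * q N) = 1.
  rewrite -jacobi_green big_ord_recl big1 /= => [|n _].
    by rewrite hp hq p0 q0 /=; ring.
  by rewrite hp hq /=; ring.
rewrite -sumrB jacobi_green !Wp !Wq //; set V := (v N)%:C in Wpq *.
rewrite -[LHS]mulr1 -Wpq; ring.
Qed.

End Jacobi.

(** * Weighted Gronwall estimates and quasinilpotence on sequences *)

Section Estimates.
Variables (R : realType) (v : nat -> R) (V : R).
Hypothesis v_gt0 : forall n, 0 < v n.
Hypothesis sum_v : forall n, \sum_(k < n) (v k)^-1 <= V.
Hypothesis v_logconcave : forall n, v n * v n.+2 <= v n.+1 ^+ 2.
Implicit Types (a x y : nat -> R[i]).

(* With these weights log-concavity makes the coefficient of a (n - 2) in the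
   recurrence for a n at most 1. *)
Let wt a n : R := Num.sqrt (v n) * nc (a n).
Let s : R := Num.sqrt (v 1%N / v 0%N).

Let wt_ge0 a n : 0 <= wt a n.
Proof. by rewrite mulr_ge0 ?sqrtr_ge0 ?normc_ge0. Qed.

Let v_ge0 n : 0 <= v n. Proof. exact: ltW. Qed.

Let V_ge0 : 0 <= V.
Proof. by have := sum_v 0; rewrite big_ord0. Qed.

Let s_ge0 : 0 <= s. Proof. exact: sqrtr_ge0. Qed.

(** Log-concavity makes the ratios [v n.+1 / v n] nonincreasing, so the first one bounds them
    all. *)
Lemma ratio_bound n : v n.+1 <= v 1%N / v 0%N * v n.
Proof.
elim: n => [|n IH]; first by rewrite divfK ?gt_eqF.
rewrite -(ler_pM2l (v_gt0 n)); apply: le_trans (v_logconcave n) _.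
by rewrite expr2 mulrCA mulrA [leRHS]mulrC ler_pM2l // mulrCA mulrC.
Qed.

(** Equation [n] is solved for [a n.+1] and multiplied by [Num.sqrt (v n.+1)]; in front of the term
    with [jacobi v a n], [ratio_bound] replaces this root by [s * Num.sqrt (v n)]. *)
Lemma wt_jacobi a n :
  wt a n.+1 <= (if n is m.+1 then wt a m else 0) + s * (wt (jacobi v a) n / v n).
Proof.
have vn := v_gt0 n; have vn1 := v_gt0 n.+1.
have sq_gt0 k : 0 < Num.sqrt (v k) by rewrite sqrtr_gt0.
have sqK k : Num.sqrt (v k) ^+ 2 = v k by rewrite sqr_sqrtr // ltW.
have sE : Num.sqrt (v n.+1) <= s * Num.sqrt (v n).
  by rewrite /s -sqrtrM ?divr_ge0 ?v_ge0 //; apply: ler_wsqrtr; exact: ratio_bound.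
have aE : v n * nc (a n.+1) <=
    (if n is m.+1 then v m * nc (a m) else 0) + nc (jacobi v a n).
  have vM k (c : R[i]) : v k * nc c = nc ((v k)%:C * c) by rewrite Normc.normcM normc_real.
  rewrite vM; case: n {vn vn1 sE} => [|n]; rewrite /jacobi.
    by rewrite addr0 add0r.
  rewrite vM -(normcN (_ * a n)).
  apply: le_trans (le_normcD _ _); rewrite le_eqVlt; apply/orP; left.
  by apply/eqP; congr nc; rewrite addrC addrK.
have -> : wt a n.+1 = Num.sqrt (v n.+1) / v n * (v n * nc (a n.+1)).
  by rewrite /wt; field; rewrite gt_eqF.
apply: le_trans (ler_wpM2l _ aE) _; first by rewrite divr_ge0 ?v_ge0.
rewrite mulrDr lerD //.
  case: n vn vn1 {sE aE} => [|n] vn vn1; first by rewrite mulr0.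
  rewrite mulrA ler_wpM2r ?normc_ge0 //.
  rewrite mulrAC ler_pdivrMr //.
  rewrite -(@ler_pXn2r _ 2) // ?nnegrE ?mulr_ge0 ?sqrtr_ge0 ?v_ge0 //.
  have -> : (Num.sqrt (v n.+2) * v n) ^+ 2 = v n * (v n * v n.+2).
    by rewrite exprMn sqK; ring.
  by rewrite exprMn sqK ler_pM2l.
have -> : s * (wt (jacobi v a) n / v n) =
    s * Num.sqrt (v n) / v n * nc (jacobi v a n) by rewrite /wt; ring.
by rewrite !ler_wpM2r ?normc_ge0 ?invr_ge0 ?v_ge0.
Qed.

(** Iterating [wt_jacobi] moves in steps of two. The sum over all [j < n] dominates the sum over one
    parity class, and [wt a 0] covers the start of both classes. *)
Lemma wt_sum a n :
  wt a n <= wt a 0 + s * \sum_(j < n) (wt (jacobi v a) j / v j).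
Proof.
set f := fun j => wt (jacobi v a) j / v j.
have f0 j : 0 <= f j by rewrite divr_ge0 ?wt_ge0 ?v_ge0.
suff /(_ n)[] : forall n, wt a n <= wt a 0 + s * \sum_(j < n) f j /\
    wt a n.+1 <= wt a 0 + s * \sum_(j < n.+1) f j by [].
elim=> [|k [IH1 IH2]].
  rewrite big_ord0 mulr0 addr0 big_ord1; split => //.
  by apply: le_trans (wt_jacobi _ _) _; rewrite lerD2r.
split => //; apply: le_trans (wt_jacobi _ _) _.
rewrite big_ord_recr /= mulrDr addrA lerD2r; apply: le_trans IH1 _.
by rewrite lerD2l ler_wpM2l // big_ord_recr /= lerDl.
Qed.

Let expV (B : R) n := expR (B * \sum_(j < n) (v j)^-1).

(** From [1 + B / v n <= expR (B / v n)]; it makes [expV B] a supersolution of the Gronwall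
    recursion. *)
Let expV_telescope (B : R) n : 0 <= B ->
  1 + B * \sum_(j < n) (expV B j / v j) <= expV B n.
Proof.
move=> B0; elim: n => [|n IH]; first by rewrite /expV !big_ord0 !mulr0 expR0 addr0.
rewrite big_ord_recr /= mulrDr addrA.
apply: le_trans (lerD IH (lexx _)) _.
rewrite {3}/expV big_ord_recr /= mulrDr expRD -/(expV B n).
have -> : expV B n + B * (expV B n / v n) = expV B n * (1 + B * (v n)^-1) by ring.
by rewrite ler_wpM2l ?expR_ge0 // expR_ge1Dx.
Qed.

Let expV_le (B : R) n : 0 <= B -> expV B n <= expR (B * V).
Proof. by move=> B0; rewrite ler_expR ler_wpM2l. Qed.

(** Comparison with [A * expV B] by strong induction; summability of [(v j)^-1] makes the bound
    uniform in [n]. *)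
Lemma gronwall_v (t : nat -> R) (A B : R) : 0 <= A -> 0 <= B ->
  (forall n, t n <= A + B * \sum_(j < n) (t j / v j)) ->
  forall n, t n <= A * expR (B * V).
Proof.
move=> A0 B0 ht.
have tE n : t n <= A * expV B n.
  elim/ltn_ind: n => n IH; apply: le_trans (ht n) _.
  apply: le_trans (_ : A * (1 + B * \sum_(j < n) (expV B j / v j)) <= _); last first.
    by rewrite ler_wpM2l // expV_telescope.
  rewrite mulrDr mulr1 lerD2l mulrCA ler_wpM2l // mulr_sumr ler_sum // => j _.
  by rewrite mulrA ler_wpM2r ?invr_ge0 ?v_ge0 // IH.
by move=> n; apply: le_trans (tE n) _; rewrite ler_wpM2l ?expV_le.
Qed.

(** Since [nc (a k) ^+ 2 <= A ^+ 2 / v k], boundedness of the weighted sequence already gives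
    square-summability. *)
Lemma wt_bound_l2 a (A : R) : 0 <= A -> (forall n, wt a n <= A) -> l2le (A ^+ 2 * V) a.
Proof.
move=> A0 ha n; apply: le_trans (_ : A ^+ 2 * \sum_(k < n) (v k)^-1 <= _); last first.
  by rewrite ler_wpM2l ?exprn_ge0.
rewrite mulr_sumr ler_sum // => k _.
rewrite ler_pdivlMr // -[X in _ * X]sqr_sqrtr ?v_ge0 // -exprMn mulrC.
by rewrite ler_pXn2r ?nnegrE //; [exact: ha | exact: wt_ge0].
Qed.

(** The summand is [nc (y j) / Num.sqrt (v j)], estimated by the inequality of arithmetic and
    geometric means; the free parameter [t] balances the two sums. *)
Lemma wt_sum_l2 y (M t : R) n : 0 < t -> l2le M y ->
  \sum_(j < n) (wt y j / v j) <= (t * M + V / t) / 2.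
Proof.
move=> t0 hy.
apply: le_trans (_ : (t * \sum_(j < n) nc (y j) ^+ 2 +
    (\sum_(j < n) (v j)^-1) / t) / 2 <= _); last first.
  rewrite ler_pM2r ?invr_gt0 // lerD // ?ler_wpM2l ?hy ?(ltW t0) //.
  by rewrite ler_pM2r ?invr_gt0 ?sum_v.
rewrite mulr_sumr mulr_suml -big_split /= mulr_suml ler_sum // => j _.
rewrite /wt; set r := Num.sqrt (v j); set b := nc (y j).
have r0 : 0 < r by rewrite sqrtr_gt0.
have -> : v j = r ^+ 2 by rewrite sqr_sqrtr ?v_ge0.
rewrite -subr_ge0.
have -> : (t * b ^+ 2 + (r ^+ 2)^-1 / t) / 2 - r * b / r ^+ 2 =
   (t * b - r^-1) ^+ 2 / (2 * t) by field; rewrite !gt_eqF.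
by rewrite divr_ge0 ?sqr_ge0 // mulr_ge0 ?(ltW t0).
Qed.

(** In [wt_sum] the part of [jacobi v a] that comes from [y] is bounded by [wt_sum_l2], and the part
    [z * a] is absorbed by Gronwall. *)
Lemma jacobi_l2 (z : R[i]) a y : l2 y -> (forall n, jacobi v a n = z * a n + y n) -> l2 a.
Proof.
move=> [M hM] haz.
pose A := wt a 0 + s * ((1 * M + V / 1) / 2).
have M0 : 0 <= M by have := hM 0%N; rewrite big_ord0.
have A0 : 0 <= A by rewrite addr_ge0 ?wt_ge0 // mulr_ge0 // mul1r divr1 divr_ge0 ?addr_ge0.
have B0 : 0 <= s * nc z by rewrite mulr_ge0 ?normc_ge0.
exists ((A * expR (s * nc z * V)) ^+ 2 * V).
apply: wt_bound_l2; first by rewrite mulr_ge0 ?expR_ge0.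
apply: gronwall_v => // n; apply: le_trans (wt_sum a n) _.
rewrite /A -addrA lerD2l -mulrA -mulrDr ler_wpM2l //.
apply: le_trans (_ : \sum_(j < n) (wt y j / v j + nc z * (wt a j / v j)) <= _).
  rewrite ler_sum // => j _; rewrite mulrA -mulrDl ler_wpM2r ?invr_ge0 ?v_ge0 //.
  rewrite /wt haz mulrCA -mulrDr ler_wpM2l ?sqrtr_ge0 // addrC -Normc.normcM.
  exact: le_normcD.
by rewrite big_split /= -mulr_sumr lerD2r wt_sum_l2.
Qed.

(** The solution operator [S] at the level of coefficient sequences. *)
Definition jinv y : nat -> R[i] := jsol v 0 y 0.

Lemma jacobi_jinv y : jacobi v (jinv y) = y.
Proof. by apply/funext => n; rewrite jacobi_jsol // mul0r add0r. Qed.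

Lemma jinv_quasinilpotent (eps : R) : 0 < eps -> exists2 C : R, 0 <= C &
  forall y (M : R), 0 < M -> l2le (M ^+ 2) y ->
  forall n, l2le ((C * eps ^+ n * M) ^+ 2) (iter n jinv y).
Proof.
(* With [s = eps * B], each application of [jinv] turns a bound by [expV B] into [eps] times that
   bound, by [expV_telescope]. *)
move=> e0; pose B := s / eps; have B0 : 0 <= B by rewrite divr_ge0 // ltW.
pose C1 := s * ((1 + V) / 2).
have C10 : 0 <= C1 by rewrite mulr_ge0 // divr_ge0 // addr_ge0.
pose D := C1 * expR (B * V) / eps.
have D0 : 0 <= D by rewrite divr_ge0 ?(ltW e0) // mulr_ge0 // expR_ge0.
(* The leading 1 covers [n = 0]; [D] contains [/ eps] because the first application gains no factor
   [eps]; [1 + V] comes from [V <= (1 + V) ^+ 2]. *)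
exists (1 + D * (1 + V)) => [|y M M0 hy [|n]].
- by rewrite addr_ge0 // mulr_ge0 // addr_ge0.
- rewrite expr0 mulr1 => m /=; apply: le_trans (hy m) _.
  rewrite ler_pXn2r // ?nnegrE ?(ltW M0) //; last first.
    by rewrite mulr_ge0 ?(ltW M0) // addr_ge0 // mulr_ge0 // addr_ge0.
  by rewrite -[leLHS]mul1r ler_wpM2r ?(ltW M0) // lerDl mulr_ge0 // addr_ge0.
have wt0 x : wt (jinv x) 0 = 0.
  by rewrite /wt (_ : jinv x 0%N = 0) // Normc.normc0 mulr0.
have C1M0 : 0 <= C1 * M by rewrite mulr_ge0 // ltW.
have bd k m : wt (iter k.+1 jinv y) m <= C1 * M * eps ^+ k * expV B m.
  elim: k m => [|k IH] m; rewrite iterS; apply: le_trans (wt_sum _ m) _;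
      rewrite wt0 add0r jacobi_jinv.
    apply: le_trans (_ : C1 * M * 1 <= _); last first.
      rewrite expr0 !mulr1 -[leLHS]mulr1 ler_wpM2l //.
      apply: le_trans (expV_telescope m B0).
      rewrite lerDl mulr_ge0 // sumr_ge0 // => j _.
      by rewrite divr_ge0 ?expR_ge0 ?v_ge0.
    rewrite /C1 mulr1 -mulrA ler_wpM2l //.
    (* The choice [t = M^-1] makes the bound linear in [M]. *)
    have Mi0 : 0 < M^-1 by rewrite invr_gt0.
    apply: le_trans (wt_sum_l2 m Mi0 hy) _.
    rewrite le_eqVlt; apply/orP; left; apply/eqP; field; exact: lt0r_neq0.
  apply: le_trans (_ : s * \sum_(j < m) (C1 * M * eps ^+ k * (expV B j / v j)) <= _).
    rewrite ler_wpM2l // ler_sum // => j _.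
    by rewrite mulrA ler_wpM2r ?invr_ge0 ?v_ge0 // IH.
  rewrite -mulr_sumr; set X := \sum_(j < m) _.
  have -> : s * (C1 * M * eps ^+ k * X) = C1 * M * eps ^+ k.+1 * (B * X).
    by rewrite /B exprS; field; exact: lt0r_neq0.
  rewrite ler_wpM2l ?(mulr_ge0 C1M0) ?exprn_ge0 ?(ltW e0) //.
  by apply: le_trans (expV_telescope m B0); rewrite lerDr.
have eM0 : 0 <= eps ^+ n.+1 * M by rewrite mulr_ge0 ?exprn_ge0 ?(ltW e0) ?(ltW M0).
have D10 : 0 <= 1 + D * (1 + V) by rewrite addr_ge0 // (mulr_ge0 D0) // addr_ge0.
have hX0 : 0 <= D * eps ^+ n.+1 * M.
  by rewrite -mulrA (mulr_ge0 D0).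
have hX : forall m, wt (iter n.+1 jinv y) m <= D * eps ^+ n.+1 * M.
  move=> m; apply: le_trans (bd n m) _.
  have -> : D * eps ^+ n.+1 * M = C1 * M * eps ^+ n * expR (B * V).
    by rewrite /D exprS; field; exact: lt0r_neq0.
  by rewrite ler_wpM2l ?expV_le // (mulr_ge0 C1M0) ?exprn_ge0 ?(ltW e0).
move=> m; apply: le_trans (wt_bound_l2 hX0 hX m) _.
have V1 : V <= (1 + V) ^+ 2 by have := V_ge0; nra.
apply: le_trans (ler_wpM2l (exprn_ge0 2 hX0) V1) _.
rewrite -exprMn ler_pXn2r ?nnegrE //.
- have -> : D * eps ^+ n.+1 * M * (1 + V) = D * (1 + V) * (eps ^+ n.+1 * M) by ring.
  by rewrite -[leRHS]mulrA ler_wpM2r ?lerDr.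
- by rewrite (mulr_ge0 hX0) // addr_ge0.
- by rewrite -mulrA (mulr_ge0 D10).
Qed.

End Estimates.

(** * Real-valued norm, limits and density in a complex Banach space *)

Section NormedSpace.
Variables (R : realType) (E : completeNormedModType R[i]).
Implicit Types x y : E.

(** The norm of [E] has values in [R[i]]; they are real, so the real part loses nothing and gives
    access to the order of [R]. *)
Definition rnorm x : R := complex.Re `|x|.

Lemma normr_rnorm x : `|x| = (rnorm x)%:C.
Proof. by rewrite /rnorm RRe_real // normr_real. Qed.

Lemma rnorm_ge0 x : 0 <= rnorm x.
Proof. by rewrite -ler0c -normr_rnorm. Qed.

Lemma ler_rnormD x y : rnorm (x + y) <= rnorm x + rnorm y.
Proof. by rewrite -lecR rmorphD /= -!normr_rnorm ler_normD. Qed.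

Lemma rnormN x : rnorm (- x) = rnorm x.
Proof. by rewrite /rnorm normrN. Qed.

Lemma rnormB x y : rnorm (x - y) = rnorm (y - x).
Proof. by rewrite -rnormN opprB. Qed.

Lemma rnormZ (c : R[i]) x : rnorm (c *: x) = nc c * rnorm x.
Proof.
by apply: (@complexI R); rewrite rmorphM /= -!normr_rnorm normrZ normr_normc.
Qed.

Lemma rnorm0 : rnorm 0 = 0.
Proof. by rewrite /rnorm normr0. Qed.

Lemma rnorm_eq0 x : rnorm x = 0 -> x = 0.
Proof. by move=> x0; apply/normr0_eq0; rewrite normr_rnorm x0. Qed.

Lemma ler_rnorm_sum n (f : 'I_n -> E) :
  rnorm (\sum_(k < n) f k) <= \sum_(k < n) rnorm (f k).
Proof.
elim/big_ind2: _ => [|x r y t xr yt|//]; first by rewrite rnorm0.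
by apply: le_trans (ler_rnormD _ _) _; rewrite lerD.
Qed.

Lemma ler_rnorm_dist z x y : rnorm (x - y) <= rnorm (x - z) + rnorm (z - y).
Proof. by apply: le_trans (ler_rnormD _ _); rewrite addrA subrK. Qed.

Definition rlim (f : nat -> E) x :=
  forall eps : R, 0 < eps -> exists n0, forall n, (n0 <= n)%N -> rnorm (x - f n) < eps.

Lemma posc_real (e : R[i]) : 0 < e -> e = (complex.Re e)%:C /\ 0 < complex.Re e.
Proof.
case: e => e1 e2; rewrite ltcE /= => /andP[/eqP -> e1_gt0].
by split.
Qed.

Lemma rlim_lim f x : rlim f x -> limn f = x.
Proof.
move=> fx; apply/cvg_lim => //.
apply/cvgrPdist_lt => e /posc_real[-> e0].
have [n0 hn0] := fx _ e0; exists n0 => // n /= /hn0.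
by rewrite normr_rnorm ltcR.
Qed.

Lemma rcauchy_rlim f :
  (forall eps : R, 0 < eps -> exists n0, forall n, (n0 <= n)%N -> rnorm (f n0 - f n) < eps) ->
  exists x, rlim f x.
Proof.
move=> hf; have cf : cvgn f.
  apply/cauchy_cvgP/cauchy_exP => e /posc_real[-> e0].
  have [n0 hn0] := hf _ e0; exists (f n0); exists n0 => // n /= /hn0.
  by rewrite -ball_normE /ball_ /= normr_rnorm ltcR.
exists (limn f) => eps e0.
have ec0 : 0 < eps%:C by rewrite ltcR.
move/cvgrPdist_lt : cf => /(_ _ ec0)[n0 _ hn0]; exists n0 => n /hn0 /=.
by rewrite normr_rnorm ltcR.
Qed.

Lemma open_rnorm (O : set E) x : open O -> O x ->
  exists2 eps : R, 0 < eps & forall y, rnorm (x - y) < eps -> O y.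
Proof.
move=> oO Ox; have : nbhs x O by apply: open_nbhs_nbhs.
case/nbhs_ballP => e /= /posc_real[-> e0] he.
exists (complex.Re e) => // y xy; apply: he.
by rewrite -ball_normE /ball_ /= normr_rnorm ltcR.
Qed.

Lemma dense_rnorm (S : set E) : dense S <->
  forall x (eps : R), 0 < eps -> exists2 y, S y & rnorm (x - y) < eps.
Proof.
split=> [dS x eps e0|dS O [x Ox] oO].
  have ec0 : 0 < eps%:C by rewrite ltcR.
  have [||y [xy Sy]] := dS (ball x eps%:C); first by exists x; exact: ballxx.
    exact: ball_open.
  by exists y => //; move: xy; rewrite -ball_normE /ball_ /= normr_rnorm ltcR.
have [eps e0 he] := open_rnorm oO Ox.
by have [y Sy /he Oy] := dS x _ e0; exists y.
Qed.

Lemma closed_rnorm2 (S : set (E * E)) :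
  (forall x y, (forall eps : R, 0 < eps -> exists x' y',
     [/\ S (x', y'), rnorm (x - x') < eps & rnorm (y - y') < eps]) -> S (x, y)) ->
  closed S.
Proof.
move=> hS [x y] xy; apply: hS => eps e0.
have ec0 : 0 < eps%:C by rewrite ltcR.
have [|[x' y'] [Sxy []]] := xy (ball (x, y) eps%:C); first exact: nbhsx_ballx.
rewrite -!ball_normE /ball_ /= !normr_rnorm !ltcR => hx hy.
by exists x', y'.
Qed.

Lemma rlim_le f x c (A : R) : rlim f x ->
  (forall n, rnorm (c - f n) <= A) -> rnorm (c - x) <= A.
Proof.
move=> fx hA; apply/ler_addgt0Pr => e e0; have [n0 /(_ n0 (leqnn _)) h] := fx e e0.
apply: le_trans (ler_rnorm_dist (f n0) _ _) _.
by rewrite lerD // (rnormB _ x) ltW.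
Qed.

Lemma half_pow_lt (A e : R) : 0 < e ->
  exists n0, forall n, (n0 <= n)%N -> A * 2^-1 ^+ n < e.
Proof.
move=> e0; exists (Num.truncn (A / e)).+1 => n hn.
have Ae : A / e < n%:R by apply: lt_le_trans (truncnS_gt _) _; rewrite ler_nat.
have n2 : n%:R <= 2 ^+ n :> R by rewrite -natrX ler_nat ltnW // ltn_expl.
rewrite exprVn ltr_pdivrMr ?exprn_gt0 // mulrC -ltr_pdivrMr //.
exact: lt_le_trans Ae n2.
Qed.

Lemma rlim_geometric f (A : R) :
  (forall n, rnorm (f n.+1 - f n) <= A * 2^-1 ^+ n) ->
  exists2 x, rlim f x & forall n, rnorm (x - f n) <= 2 * A * 2^-1 ^+ n.
Proof.
move=> hf; have A0 : 0 <= A.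
  by have := hf 0%N; rewrite expr0 mulr1; apply: le_trans (rnorm_ge0 _).
have h2 n : 0 <= 2^-1 ^+ n :> R by rewrite exprn_ge0 // invr_ge0.
(* Subtracting the exact remainder of the geometric series lets the induction on [k] close. *)
have tail n k : rnorm (f n - f (n + k)%N) <= 2 * A * 2^-1 ^+ n - 2 * A * 2^-1 ^+ (n + k).
  elim: k => [|k IH]; first by rewrite addn0 !subrr rnorm0.
  apply: le_trans (ler_rnorm_dist (f (n + k)%N) _ _) _.
  apply: le_trans (lerD IH _) _; first by rewrite rnormB addnS; exact: hf.
  rewrite addnS exprS; lra.
have tail' n m : (n <= m)%N -> rnorm (f n - f m) <= 2 * A * 2^-1 ^+ n.
  move=> nm; rewrite -(subnKC nm); apply: le_trans (tail _ _) _.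
  by rewrite lerBlDr lerDl !mulr_ge0.
have [|x fx] := @rcauchy_rlim f.
  move=> eps e0; have [n0 /(_ n0 (leqnn _)) hn0] := half_pow_lt (2 * A) e0.
  by exists n0 => n /tail' h; apply: le_lt_trans hn0.
exists x => // n; apply/ler_addgt0Pr => e e0; have [n0 hn0] := fx e e0.
apply: le_trans (ler_rnorm_dist (f (maxn n n0)) _ _) _.
rewrite addrC lerD //; first by rewrite rnormB tail' // leq_maxl.
by rewrite ltW // hn0 // leq_maxr.
Qed.

End NormedSpace.

(** * Hilbert space geometry and orthogonal complements *)

Section InnerProduct.
Variables (R : realType) (E : completeNormedModType R[i]).
Variable inner : {dot E for Num.conj}.
Hypothesis hE : hilbert_norm inner.
Implicit Types x y : E.

Lemma conj_realC (a : R) : Num.conj a%:C = a%:C.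
Proof. by apply: CrealP; apply/complex_realP; exists a. Qed.

Lemma innerC x y : inner x y = Num.conj (inner y x).
Proof. by rewrite hermC expr0 mul1r. Qed.

Lemma inner_rnorm x : inner x x = (rnorm x ^+ 2)%:C.
Proof. by rewrite -hE normr_rnorm rmorphXn. Qed.

Lemma rnorm_pythagoras x y : inner x y = 0 ->
  rnorm (x + y) ^+ 2 = rnorm x ^+ 2 + rnorm y ^+ 2.
Proof.
move=> xy; apply: (@complexI R); rewrite rmorphD /= -!inner_rnorm.
by rewrite hnormDd.
Qed.

Lemma parallelogram x y :
  rnorm (x + y) ^+ 2 + rnorm (x - y) ^+ 2 = 2 * (rnorm x ^+ 2 + rnorm y ^+ 2).
Proof.
apply: (@complexI R); rewrite rmorphM !rmorphD /= -!inner_rnorm dnormD dnormB.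
rewrite rmorph1; ring.
Qed.

(** Pythagoras for the projection onto the line of [y]; it yields both the Cauchy-Schwarz inequality
    and the orthogonality in [dense_of_orthogonal]. *)
Lemma rnorm_sub_proj x y : y != 0 ->
  rnorm (x - (inner x y / inner y y) *: y) ^+ 2 =
  rnorm x ^+ 2 - nc (inner x y) ^+ 2 / rnorm y ^+ 2.
Proof.
move=> y0; have yy : inner y y != 0 by rewrite dnorm_eq0.
set t := inner x y / inner y y.
have o : inner (x - t *: y) (t *: y) = 0.
  by rewrite linearZr_LR /= linearBl linearZl_LR /= divfK // subrr mulr0.
have := rnorm_pythagoras o; rewrite subrK => ->.
rewrite rnormZ exprMn Normc.normcM exprMn Normc.normcV (inner_rnorm y).
have r0 : rnorm y != 0 by apply: contra_neq y0 => /rnorm_eq0.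
by rewrite normc_real ?exprn_ge0 ?rnorm_ge0 //; field.
Qed.

Lemma inner_CS x y : nc (inner x y) <= rnorm x * rnorm y.
Proof.
have [->|y0] := eqVneq y 0.
  by rewrite linear0r Normc.normc0 mulr_ge0 ?rnorm_ge0.
have r0 : 0 < rnorm y.
  by rewrite lt_def rnorm_ge0 andbT; apply: contra_neq y0 => /rnorm_eq0.
rewrite -(@ler_pXn2r _ 2) ?nnegrE ?normc_ge0 ?mulr_ge0 ?rnorm_ge0 //.
rewrite exprMn -ler_pdivrMr ?exprn_gt0 // -subr_ge0 -rnorm_sub_proj //.
by rewrite sqr_ge0.
Qed.

Lemma innerBl x y z : inner (x - y) z = inner x z - inner y z.
Proof. exact: linearBl. Qed.

Lemma innerNr x y : inner x (- y) = - inner x y.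
Proof. exact: linearNr. Qed.

Lemma rlim_inner f x y (c : R[i]) : rlim f x ->
  (forall eps : R, 0 < eps -> exists n0, forall n, (n0 <= n)%N ->
     nc (inner (f n) y - c) < eps) -> inner x y = c.
Proof.
move=> fx fc; apply/eqP; rewrite -subr_eq0; apply/eqP/Normc.eq0_normc/eqP.
rewrite eq_le normc_ge0 andbT; apply/ler_addgt0Pr => e e0; rewrite add0r.
have y1 : 0 < 1 + rnorm y by rewrite ltr_pwDl ?rnorm_ge0.
have d0 : 0 < e / 2 / (1 + rnorm y) by rewrite !divr_gt0.
have [n1 hn1] := fx _ d0; have [n2 hn2] := fc (e / 2) (divr_gt0 e0 (ltr0Sn _ 1)).
pose n := maxn n1 n2; rewrite -(subrK (inner (f n) y) (inner x y)) -innerBl -addrA.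
apply: le_trans (le_normcD _ _) _.
rewrite [e]splitr lerD //; last by rewrite ltW // hn2 // leq_maxr.
apply: le_trans (inner_CS _ _) _.
have := hn1 n (leq_maxl _ _); rewrite ltr_pdivlMr // => /ltW; apply: le_trans.
by rewrite ler_wpM2l ?rnorm_ge0 // lerDr.
Qed.

(* A minimizing sequence for the distance from x to S is Cauchy by the parallelogram law,
   and x minus its limit is orthogonal to S. *)
Lemma dense_of_orthogonal (S : set E) : S 0 ->
  (forall c x y, S x -> S y -> S (c *: x + y)) ->
  (forall f, (forall x, S x -> inner x f = 0) -> f = 0) ->
  forall x (eps : R), 0 < eps -> exists2 y, S y & rnorm (x - y) < eps.
Proof.
move=> S0 Slin Sorth x.
pose D := [set rnorm (x - y) | y in S]; pose d := inf D.
have hD : has_inf D.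
  split; first by exists (rnorm (x - 0)), 0.
  by exists 0 => _ [y _ <-]; exact: rnorm_ge0.
have dle y : S y -> d <= rnorm (x - y) by move=> Sy; apply: ge_inf hD.2 _ _; exists y.
have d0 : 0 <= d by apply: lb_le_inf hD.1 _ => _ [y _ <-]; exact: rnorm_ge0.
have h0 n : 0 < 2^-1 ^+ n :> R by rewrite exprn_gt0 // invr_gt0.
have h1 n : 2^-1 ^+ n <= 1 :> R by rewrite exprn_ile1 ?invr_ge0 // invf_le1 ?ler1n.
have ex n : exists y, S y /\ rnorm (x - y) < d + 2^-1 ^+ n.
  by have [_ [y Sy <-] h] := inf_adherent (h0 n) hD; exists y.
have /choice[m hm] := ex.
have mid y z : S y -> S z -> S (2^-1 *: (y + z)).
  move=> Sy Sz; rewrite -[2^-1 *: _]addr0; apply: (Slin) => //.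
  by rewrite -[y]scale1r; apply: (Slin).
have mle n k : (n <= k)%N -> rnorm (x - m k) <= d + 2^-1 ^+ n.
  move=> nk; apply: le_trans (ltW (hm k).2) _.
  by rewrite lerD2l ler_wiXn2l ?invr_ge0 // invf_le1 ?ler1n.
suff [l ml] : exists l, rlim m l.
  have xl : x = l.
    apply/eqP; rewrite -subr_eq0; apply/eqP/Sorth => y Sy.
    have rd : rnorm (x - l) <= d.
      apply/ler_addgt0Pr => e e0; have [n1 hn1] := ml _ (divr_gt0 e0 (ltr0Sn _ 1)).
      have [n2 hn2] := half_pow_lt 1 (divr_gt0 e0 (ltr0Sn _ 1)).
      have := hn1 _ (leq_maxl n1 n2); have := hn2 n2 (leqnn _).
      have := mle _ _ (leq_maxr n1 n2).
      have := ler_rnorm_dist (m (maxn n1 n2)) x l; rewrite (rnormB (m _) l); lra.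
    have [->|y0] := eqVneq y 0; first by rewrite linear0l.
    set c := inner (x - l) y / inner y y.
    (* [l] is only a limit of vectors of [S], so the distance bound for [l + c *: y] is taken from
       the vectors [c *: y + m n1], which lie in [S]. *)
    have dc : d <= rnorm (x - l - c *: y).
      apply/ler_addgt0Pr => e e0; have [n1 /(_ _ (leqnn _)) hn1] := ml _ e0.
      apply: le_trans (dle (c *: y + m n1) _) _; first exact: Slin (hm _).1.
      apply: le_trans (ler_rnorm_dist (l + c *: y) _ _) _.
      rewrite opprD addrA lerD //.
      have -> : l + c *: y - (c *: y + m n1) = l - m n1.
        by rewrite [c *: y + _]addrC opprD addrA addrAC addrK.
      exact: ltW.
    have := rnorm_sub_proj (x - l) y0; rewrite -/c.
    have := rnorm_ge0 (x - l); have := rnorm_ge0 (x - l - c *: y).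
    have ry : 0 < rnorm y by rewrite lt_def rnorm_ge0 andbT; apply: contra_neq y0 => /rnorm_eq0.
    move=> g1 g2 g3; rewrite innerC (_ : inner _ _ = 0) ?rmorph0 //.
    apply: Normc.eq0_normc; apply/eqP; rewrite -sqrf_eq0 eq_le sqr_ge0 andbT.
    have g4 : rnorm (x - l) ^+ 2 <= rnorm (x - l - c *: y) ^+ 2.
      by rewrite ler_pXn2r ?nnegrE // (le_trans rd).
    have : nc (inner (x - l) y) ^+ 2 / rnorm y ^+ 2 <= 0 by lra.
    by rewrite ler_pdivrMr ?exprn_gt0 // mul0r.
  move=> eps e0; have [n0 /(_ _ (leqnn _)) hn0] := ml _ e0.
  by exists (m n0); [exact: (hm n0).1 | rewrite xl].
apply: rcauchy_rlim => eps e0.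
(* The parallelogram law bounds the squared distance by [4 * (d + e) ^+ 2 - 4 * d ^+ 2 = 8 * d * e +
   4 * e ^+ 2], which is at most [(8 * d + 4) * e] as [e <= 1]. *)
have [n0 /(_ _ (leqnn _)) hn0] := half_pow_lt (8 * d + 4) (exprn_gt0 2 e0).
exists n0 => n nn0; set e := 2^-1 ^+ n0 in hn0.
rewrite -(@ltr_pXn2r _ 2) ?nnegrE ?rnorm_ge0 ?(ltW e0) //.
apply: le_lt_trans hn0.
have := parallelogram (x - m n) (x - m n0).
have -> : x - m n - (x - m n0) = m n0 - m n by rewrite opprB addrC addrA subrK.
have -> : x - m n + (x - m n0) = 2 *: (x - 2^-1 *: (m n + m n0)).
  rewrite scalerBr scalerA divff ?scale1r ?pnatr_eq0 // scaler_nat mulr2n.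
  by rewrite opprD addrACA.
rewrite rnormZ exprMn.
have -> : nc (2 : R[i]) = 2.
  have -> : (2 : R[i]) = (2 : R)%:C by rewrite [RHS](rmorph_nat (real_complex R) 2).
  by rewrite normc_real.
have := dle _ (mid _ _ (hm n).1 (hm n0).1).
have := mle _ _ nn0; have := mle _ _ (leqnn n0); rewrite -/e.
have := rnorm_ge0 (x - m n); have := rnorm_ge0 (x - m n0).
have := h1 n0; have := h0 n0; rewrite -/e.
set A := rnorm (x - m n0); set B := rnorm (x - m n); set C := rnorm (x - _).
move=> e1 e2 A0 B0 Ad Bd Cd.
have A2 : A ^+ 2 <= (d + e) ^+ 2 by rewrite ler_pXn2r ?nnegrE // (le_trans A0).
have B2 : B ^+ 2 <= (d + e) ^+ 2 by rewrite ler_pXn2r ?nnegrE // (le_trans B0).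
have C2 : d ^+ 2 <= C ^+ 2 by rewrite ler_pXn2r ?nnegrE // (le_trans d0).
have ee : e ^+ 2 <= e by rewrite expr2 ger_pMl.
by nra.
Qed.

End InnerProduct.

(** * Fourier coefficients in an orthonormal basis *)

Section OrthonormalBasis.
Variables (R : realType) (E : completeNormedModType R[i]).
Variables (inner : {dot E for Num.conj}) (b : nat -> E).
Hypothesis hE : hilbert_norm inner.
Hypothesis b_orthonormal : forall m n, inner (b m) (b n) = (m == n)%:R.
Hypothesis b_total : forall x (eps : R), 0 < eps ->
  exists N (c : nat -> R[i]), rnorm (x - \sum_(k < N) c k *: b k) < eps.
Implicit Types (x y : E) (a c : nat -> R[i]).

Definition fourier x n : R[i] := inner x (b n).

Definition psum a n : E := \sum_(k < n) a k *: b k.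

(** Meaningful when the partial sums converge, in particular for [l2 a]. *)
Definition vec a : E := limn (psum a).

Lemma psumS a n : psum a n.+1 = psum a n + a n *: b n.
Proof. by rewrite /psum big_ord_recr. Qed.

Lemma fourierD x y n : fourier (x + y) n = fourier x n + fourier y n.
Proof. exact: linearDl. Qed.

Lemma fourierZ (t : R[i]) x n : fourier (t *: x) n = t * fourier x n.
Proof. exact: linearZl_LR. Qed.

Lemma fourierB x y n : fourier (x - y) n = fourier x n - fourier y n.
Proof. exact: linearBl. Qed.

Lemma inner_psum x a n : inner (psum a n) x = \sum_(k < n) a k * Num.conj (fourier x k).
Proof.
rewrite /psum linear_sumlz; apply: eq_bigr => k _.
by rewrite linearZl_LR /= innerC.
Qed.

Lemma fourier_psum a N n : fourier (psum a N) n = if (n < N)%N then a n else 0.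
Proof.
elim: N => [|N IH]; first by rewrite /fourier /psum big_ord0 linear0l.
rewrite psumS fourierD fourierZ IH /fourier b_orthonormal [(n < N.+1)%N]ltnS.
by case: (ltngtP n N) => [_|_|->] /=; rewrite ?mulr0 ?addr0 ?mulr1 ?add0r.
Qed.

Lemma rnorm_basis n : rnorm (b n) = 1.
Proof.
apply/eqP; rewrite -(@eqrXn2 _ 2) ?rnorm_ge0 // expr1n; apply/eqP/(@complexI R).
by rewrite -(inner_rnorm hE) b_orthonormal eqxx.
Qed.

Lemma rnorm_psumB a m n : (m <= n)%N -> rnorm (psum a n - psum a m) ^+ 2 =
  \sum_(k < n) nc (a k) ^+ 2 - \sum_(k < m) nc (a k) ^+ 2.
Proof.
elim: n => [|n IH]; first by rewrite leqn0 => /eqP ->; rewrite !subrr rnorm0 expr0n.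
rewrite leq_eqVlt => /orP[/eqP -> | mn]; first by rewrite !subrr rnorm0 expr0n.
rewrite psumS addrAC (rnorm_pythagoras hE); last first.
  rewrite linearZr_LR /= -/(fourier _ n) fourierB !fourier_psum ltnn ltnNge.
  by rewrite -ltnS mn subrr mulr0.
by rewrite IH // rnormZ rnorm_basis mulr1 big_ord_recr /= addrAC.
Qed.

Lemma rnorm_psum a n : rnorm (psum a n) ^+ 2 = \sum_(k < n) nc (a k) ^+ 2.
Proof.
have := rnorm_psumB a (leq0n n).
by rewrite /psum !big_ord0 !subr0.
Qed.

Lemma bessel x : l2le (rnorm x ^+ 2) (fourier x).
Proof.
move=> n; rewrite -rnorm_psum.
have o : inner (x - psum (fourier x) n) (psum (fourier x) n) = 0.
  rewrite innerC inner_psum big1 ?rmorph0 // => k _.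
  by rewrite fourierB fourier_psum ltn_ord subrr rmorph0 mulr0.
have := rnorm_pythagoras hE o; rewrite subrK => ->.
by rewrite lerDr sqr_ge0.
Qed.

Lemma l2_fourier x : l2 (fourier x).
Proof. by exists (rnorm x ^+ 2); exact: bessel. Qed.

(** A vector [r] with vanishing coefficients is orthogonal to every finite combination, so by
    Pythagoras none of them is closer to [r] than 0 is; totality forces [r = 0]. *)
Lemma fourier_inj x y : fourier x = fourier y -> x = y.
Proof.
move=> xy; apply/eqP; rewrite -subr_eq0; apply/eqP.
have : fourier (x - y) = fun=> 0 by apply/funext => n; rewrite fourierB xy subrr.
move: (x - y) => r cr.
apply: rnorm_eq0; apply/eqP; rewrite eq_le rnorm_ge0 andbT.
apply/ler_addgt0Pr => e e0; rewrite add0r.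
have [N [c hc]] := b_total r e0.
apply: le_trans (ltW hc).
rewrite -(@ler_pXn2r _ 2) ?nnegrE ?rnorm_ge0 // (rnorm_pythagoras hE).
  by rewrite lerDl sqr_ge0.
rewrite innerNr -/(psum c N) innerC inner_psum big1 ?rmorph0 ?oppr0 // => k _.
by rewrite cr rmorph0 mulr0.
Qed.

Lemma fourier_le x n : nc (fourier x n) <= rnorm x.
Proof. by rewrite -[leRHS]mulr1 -(rnorm_basis n) inner_CS. Qed.

Lemma rlim_psum_vec a : l2 a -> rlim (psum a) (vec a).
Proof.
move=> [M hM]; have [|l hl] := @rcauchy_rlim _ _ (psum a); last first.
  by rewrite /vec (rlim_lim hl).
move=> eps e0; pose t n := \sum_(k < n) nc (a k) ^+ 2.
have ht : has_sup (range t).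
  by split; [exists (t 0%N), 0%N | exists M => _ [n _ <-]; exact: hM].
have [_ [n0 _ <-] hn0] := sup_adherent (exprn_gt0 2 e0) ht.
exists n0 => n nn0; rewrite -(@ltr_pXn2r _ 2) ?nnegrE ?rnorm_ge0 ?(ltW e0) //.
rewrite rnormB rnorm_psumB // -/(t n) -/(t n0).
have : t n <= sup (range t) by apply: ub_le_sup ht.2 _ _; exists n.
by move: hn0; lra.
Qed.

Lemma fourier_vec a : l2 a -> fourier (vec a) = a.
Proof.
move=> ha; apply/funext => n; apply: (rlim_inner hE (rlim_psum_vec ha)) => eps e0.
exists n.+1 => m nm; rewrite -/(fourier _ n) fourier_psum nm subrr Normc.normc0 //.
Qed.

Lemma vec_fourier x : vec (fourier x) = x.
Proof. by apply: fourier_inj; rewrite fourier_vec //; exact: l2_fourier. Qed.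

Lemma rnorm_vec a (M : R) : 0 <= M -> l2le (M ^+ 2) a -> rnorm (vec a) <= M.
Proof.
move=> M0 hM; have ha : l2 a by exists (M ^+ 2).
rewrite -[vec a]opprK rnormN -[- _]sub0r.
apply: (rlim_le (rlim_psum_vec ha)) => n; rewrite sub0r rnormN.
by rewrite -(@ler_pXn2r _ 2) ?nnegrE ?rnorm_ge0 // rnorm_psum.
Qed.

(** Parseval's identity, in filter form so that [cvgB] and [cvgM] apply to it in [sinv_green]. *)
Lemma inner_fourier_cvg x y :
  (fun n => \sum_(k < n) fourier x k * Num.conj (fourier y k)
     : (R[i] : numFieldType)^o) @ \oo --> inner x y.
Proof.
apply/cvgrPdist_lt => eps /posc_real[-> e0]; set e := complex.Re eps in e0 *.
have y1 : 0 < 1 + rnorm y by rewrite ltr_pwDl ?rnorm_ge0.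
have d0 : 0 < e / (1 + rnorm y) by rewrite divr_gt0.
have [n0 hn0] := rlim_psum_vec (l2_fourier x) d0.
exists n0 => // n /= /hn0; rewrite vec_fourier -inner_psum -innerBl => h.
rewrite normr_normc ltcR; apply: le_lt_trans (inner_CS hE _ _) _.
apply: le_lt_trans (_ : rnorm (x - psum (fourier x) n) * (1 + rnorm y) < _).
  by rewrite ler_wpM2l ?rnorm_ge0 // lerDr.
by rewrite -ltr_pdivlMr.
Qed.

End OrthonormalBasis.

(** * Formal powers, the operator [S], and its periodic and hypercyclic series *)

Section JacobiDynamics.
Variables (R : realType) (E : completeNormedModType R[i]).
Variables (inner : {dot E for Num.conj}) (b : nat -> E).
Hypothesis hE : hilbert_norm inner.
Hypothesis b_orthonormal : forall m n, inner (b m) (b n) = (m == n)%:R.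
Hypothesis b_total : forall x (eps : R), 0 < eps ->
  exists N (c : nat -> R[i]), rnorm (x - \sum_(k < N) c k *: b k) < eps.
Variables (v : nat -> R) (V : R).
Hypothesis v_gt0 : forall n, 0 < v n.
Hypothesis sum_v : forall n, \sum_(k < n) (v k)^-1 <= V.
Hypothesis v_logconcave : forall n, v n * v n.+2 <= v n.+1 ^+ 2.
Implicit Types (x y f : E).

Local Notation cf := (fourier inner b).

(** Formal power on coefficients, defined for every [x]; domains enter later as square-summability
    of this sequence. *)
Definition jpow m x : nat -> R[i] := iter m (jacobi v) (cf x).

Definition sinv x : E := vec b (jinv v (cf x)).

(** [psol] and [qsol] are the values at 0 of the orthogonal polynomials of the first and second
    kind. *)
Definition psol : E := vec b (jsol v 0 (fun=> 0) 1).

Definition qsol : E := vec b (jsol v 0 (fun n => (n == 0%N)%:R) 0).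

Let l2_jsol0 (y : nat -> R[i]) (a : R[i]) : l2 y -> l2 (jsol v 0 y a).
Proof.
move=> hy; apply: (jacobi_l2 v_gt0 sum_v v_logconcave hy (z := 0)).
exact: jacobi_jsol.
Qed.

Lemma fourier_sinv x : cf (sinv x) = jinv v (cf x).
Proof.
rewrite fourier_vec //; apply: l2_jsol0; exact: (l2_fourier hE b_orthonormal).
Qed.

Lemma fourier_iter_sinv n x : cf (iter n sinv x) = iter n (jinv v) (cf x).
Proof. by elim: n => // n IH; rewrite !iterS fourier_sinv IH. Qed.

Lemma fourier_psol : cf psol = jsol v 0 (fun=> 0) 1.
Proof.
rewrite fourier_vec //; apply: l2_jsol0; exists 0 => n.
by rewrite big1 // => k _; rewrite Normc.normc0 expr0n.
Qed.

Lemma fourier_qsol : cf qsol = jsol v 0 (fun n => (n == 0%N)%:R) 0.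
Proof.
rewrite fourier_vec //; apply: l2_jsol0; exists 1 => -[|n]; first by rewrite big_ord0.
rewrite big_ord_recl big1 => [|k _]; last by rewrite mulr0n Normc.normc0 expr0n.
by rewrite mulr1n Normc.normc1 expr1n addr0.
Qed.

Lemma jacobi_sinv x : jacobi v (cf (sinv x)) = cf x.
Proof. by rewrite fourier_sinv jacobi_jinv. Qed.

Lemma jacobi_psol : jacobi v (cf psol) = fun=> 0.
Proof. by apply/funext => n; rewrite fourier_psol jacobi_jsol // mul0r addr0. Qed.

Lemma jacobi0 : jacobi v (fun=> 0) = fun=> 0.
Proof. by apply/funext => -[|n]; rewrite /jacobi !mulr0 addr0. Qed.

Lemma iter_jacobi0 m : iter m (jacobi v) (fun=> 0) = fun=> 0.
Proof. by elim: m => // m IH; rewrite iterS IH jacobi0. Qed.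

Lemma jpow_sinv_le m n x : (m <= n)%N ->
  jpow m (iter n sinv x) = cf (iter (n - m) sinv x).
Proof.
rewrite /jpow; elim: m n => [|m IH] [|n] //; rewrite ltnS => mn.
by rewrite iterSr subSS iterS jacobi_sinv IH.
Qed.

Lemma jpow_sinv_ge m n x : (n <= m)%N ->
  jpow m (iter n sinv x) = jpow (m - n) x.
Proof.
rewrite /jpow; elim: m n => [|m IH] [|n] //; rewrite ltnS => mn.
by rewrite iterSr subSS iterS jacobi_sinv IH.
Qed.

Lemma jpow_lin m (c : R[i]) x y n :
  jpow m (c *: x + y) n = c * jpow m x n + jpow m y n.
Proof.
rewrite /jpow -iter_jacobi_lin; congr (iter m _ _ n).
by apply/funext => k; rewrite fourierD fourierZ.
Qed.

Lemma jpowD m x y n : jpow m (x + y) n = jpow m x n + jpow m y n.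
Proof. by rewrite -{1}[x]scale1r jpow_lin mul1r. Qed.

Lemma jpow0 m : jpow m 0 = fun=> 0.
Proof.
rewrite /jpow (_ : cf 0 = fun=> 0) ?iter_jacobi0 //.
by apply/funext => n; exact: linear0l.
Qed.

Lemma jpowB m x y n : jpow m (x - y) n = jpow m x n - jpow m y n.
Proof.
by rewrite addrC -scaleN1r jpow_lin mulN1r addrC.
Qed.

Lemma jpow_sum m k (g : 'I_k -> E) n :
  jpow m (\sum_(i < k) g i) n = \sum_(i < k) jpow m (g i) n.
Proof.
apply: (big_morph (fun x => jpow m x n)); last by rewrite jpow0.
by move=> x y; exact: jpowD.
Qed.

(** A power of a Jacobi matrix has finitely many entries in each row, so every coordinate of
    [jpow m] is a continuous functional. *)
Lemma jpow_bounded m n : exists2 C : R, 0 <= C & forall x, nc (jpow m x n) <= C * rnorm x.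
Proof.
elim: m n => [|m IH] n.
  by exists 1 => // x; rewrite mul1r /jpow /= fourier_le.
have [C1 C10 h1] := IH n.+1; have [C2 C20 h2] := IH n.-1.
have v0 k : 0 <= v k by rewrite ltW.
exists (v n * C1 + v n.-1 * C2) => [|x]; first by rewrite addr_ge0 ?mulr_ge0.
rewrite /jpow iterS -/(jpow m x) /jacobi mulrDl.
apply: le_trans (le_normcD _ _) _; rewrite lerD //.
  by rewrite Normc.normcM normc_real // -mulrA ler_wpM2l.
case: n h2 {h1} => [|n] h2.
  by rewrite Normc.normc0 !mulr_ge0 // rnorm_ge0.
by rewrite Normc.normcM normc_real // -mulrA ler_wpM2l.
Qed.

(** Coordinatewise passage to the limit. It serves both to close the powers of the operator and to
    evaluate formal powers on infinite series. *)
Lemma jpow_closed m x y : (forall eps : R, 0 < eps -> exists x' y',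
    [/\ jpow m x' = cf y', rnorm (x - x') < eps & rnorm (y - y') < eps]) ->
  jpow m x = cf y.
Proof.
move=> hxy; apply/funext => n.
apply/eqP; rewrite -subr_eq0; apply/eqP/Normc.eq0_normc/eqP.
rewrite eq_le normc_ge0 andbT; apply/ler_addgt0Pr => e e0; rewrite add0r.
have [C C0 hC] := jpow_bounded m n; have C1 : 0 < C + 1 by rewrite ltr_wpDl.
have [x' [y' [h1 h2 h3]]] := hxy _ (divr_gt0 e0 C1).
have -> : jpow m x n - cf y n = jpow m (x - x') n - cf (y - y') n.
  by rewrite jpowB fourierB h1; ring.
apply: le_trans (le_normcD _ _) _; rewrite normcN.
apply: le_trans (lerD (hC _) (fourier_le hE b_orthonormal _ _)) _.
apply: le_trans (_ : (C + 1) * (e / (C + 1)) <= _); last first.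
  by rewrite mulrC divfK ?lt0r_neq0.
by rewrite mulrDl mul1r lerD ?(ltW h3) // ler_wpM2l // ltW.
Qed.

(** The offset [k0] aligns the partial sums of a series with those of its image, whose first terms
    may have been annihilated. *)
Lemma jpow_rlim m k0 (f g : nat -> E) x y : rlim f x -> rlim g y ->
  (forall k, jpow m (f (k0 + k)%N) = cf (g k)) -> jpow m x = cf y.
Proof.
move=> fx gy h; apply: jpow_closed => eps e0.
have [n1 h1] := fx _ e0; have [n2 h2] := gy _ e0.
exists (f (k0 + maxn n1 n2)%N), (g (maxn n1 n2)); split => //.
  by apply: h1; rewrite (leq_trans (leq_maxl n1 n2)) // leq_addl.
by apply: h2; exact: leq_maxr.
Qed.

(** Descent by one power at a time, through [jacobi_l2] with [z = 0]. *)
Lemma l2_jpow_le m n x : (m <= n)%N -> l2 (jpow n x) -> l2 (jpow m x).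
Proof.
move=> mn; rewrite -(subnK mn); elim: (n - m)%N => // k IH h; apply: IH.
apply: (jacobi_l2 v_gt0 sum_v v_logconcave h (z := 0)) => i.
by rewrite mul0r add0r /jpow addSn iterS.
Qed.

Lemma sinv_quasinilpotent (eps : R) : 0 < eps -> exists2 C : R, 0 <= C &
  forall x M, 0 < M -> rnorm x <= M ->
  forall n, rnorm (iter n sinv x) <= C * eps ^+ n * M.
Proof.
move=> e0; have [C C0 hC] := jinv_quasinilpotent v_gt0 sum_v v_logconcave e0.
exists C => // x M M0 xM n; rewrite -(vec_fourier hE b_orthonormal b_total (iter n _ _)).
apply: rnorm_vec => //; first by rewrite !mulr_ge0 ?exprn_ge0 ?(ltW e0) ?(ltW M0).
rewrite fourier_iter_sinv; apply: hC => // m.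
apply: le_trans (bessel hE b_orthonormal _ _) _.
by rewrite ler_pXn2r ?nnegrE ?rnorm_ge0 ?(ltW M0).
Qed.

Lemma jacobi_conj (a : nat -> R[i]) n :
  jacobi v (fun k => Num.conj (a k)) n = Num.conj (jacobi v a n).
Proof.
rewrite /jacobi rmorphD rmorphM /= conj_realC; case: n => [|n]; first by rewrite rmorph0.
by rewrite rmorphM /= conj_realC.
Qed.

(** Conjugation preserves the recurrence and its real data, so [jacobi_inj] applies. *)
Lemma conj_jsol (y : nat -> R[i]) (a : R[i]) n :
  (forall n, Num.conj (y n) = y n) -> Num.conj a = a ->
  Num.conj (jsol v 0 y a n) = jsol v 0 y a n.
Proof.
move=> hy ha.
suff /(congr1 (@^~ n)) /= <- : jsol v 0 y a = fun n => Num.conj (jsol v 0 y a n) by [].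
apply: (jacobi_inj (z := 0) (y := y) v_gt0) => // k; first exact: jacobi_jsol.
rewrite mul0r add0r -[RHS]hy.
have := congr1 Num.conj (jacobi_jsol 0 y a v_gt0 k); rewrite mul0r add0r => <-.
exact: jacobi_conj.
Qed.

(** Limit of [jacobi_plucker] along partial sums, with [psol] and [qsol] real: [S] differs from its
    adjoint by an operator of rank at most two. *)
Lemma sinv_green x y : inner (sinv x) y - inner x (sinv y) =
  inner x psol * inner qsol y - inner x qsol * inner psol y.
Proof.
have cvg1 := inner_fourier_cvg hE b_orthonormal b_total.
pose s x y n : (R[i] : numFieldType)^o := \sum_(k < n) cf x k * Num.conj (cf y k).
have E1 : s (sinv x) y \- s x (sinv y) = s x psol \* s qsol y \- s x qsol \* s psol y.
  apply/funext => N /=.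
  have hp k : Num.conj (cf psol k) = cf psol k.
    by rewrite fourier_psol conj_jsol // ?rmorph0 ?rmorph1.
  have hq k : Num.conj (cf qsol k) = cf qsol k.
    by rewrite fourier_qsol conj_jsol // ?rmorph0 // => n; rewrite rmorph_nat.
  have hJ : jacobi v (fun n => Num.conj (cf (sinv y) n)) = fun n => Num.conj (cf y n).
    by apply/funext => n; rewrite jacobi_conj jacobi_sinv.
  have := @jacobi_plucker _ v (cf psol) (cf qsol) (cf (sinv x))
    (fun n => Num.conj (cf (sinv y) n)) N.
  rewrite hJ jacobi_sinv => ->.
  - rewrite /s; congr (_ * _ - _ * _); apply: eq_bigr => k _; by rewrite ?hp ?hq // mulrC.
  - by rewrite fourier_psol.
  - by rewrite fourier_qsol.
  - by rewrite fourier_sinv.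
  - by rewrite fourier_sinv rmorph0.
  - by move=> n; rewrite jacobi_psol.
  - by move=> n; rewrite fourier_qsol jacobi_jsol // mul0r add0r.
have lhs : s (sinv x) y \- s x (sinv y) @ \oo --> inner (sinv x) y - inner x (sinv y).
  by apply: cvgB; exact: cvg1.
have rhs : s x psol \* s qsol y \- s x qsol \* s psol y @ \oo -->
    inner x psol * inner qsol y - inner x qsol * inner psol y.
  by apply: cvgB; apply: cvgM; exact: cvg1.
rewrite E1 in lhs.
exact: (cvg_unique _ lhs rhs).
Qed.

Local Notation S := sinv.
Local Notation p := psol.
Local Notation q := qsol.
Local Notation jp := jpow.

Definition gen_kernel : set E := [set x | exists m, jp m x = fun=> 0].

Lemma gen_kernel_le m n x : (m <= n)%N -> jp m x = (fun=> 0) -> jp n x = fun=> 0.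
Proof. by move=> mn h; rewrite /jpow -(subnK mn) iterD -/(jp m x) h iter_jacobi0. Qed.

(** If [t 1] were positive, log-convexity would force growth at least like [(t 1 / t 0) ^+ n],
    against decay faster than every geometric sequence. *)
Lemma logconvex_eq0 (t : nat -> R) : (forall n, 0 <= t n) ->
  (forall n, t n.+1 ^+ 2 <= t n * t n.+2) ->
  (forall eps : R, 0 < eps -> exists C, forall n, t n <= C * eps ^+ n) -> t 1%N = 0.
Proof.
move=> t0 tc td; apply/eqP/negP => /negP t1.
have t1_gt0 : 0 < t 1%N by rewrite lt_def t1 t0.
have t0_gt0 : 0 < t 0%N.
  rewrite lt_def t0 andbT; apply/negP => /eqP t00.
  by have := tc 0%N; rewrite t00 mul0r leNgt exprn_gt0.
pose r := t 1%N / t 0%N; have r0 : 0 < r by rewrite divr_gt0.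
have tr n : 0 < t n /\ r * t n <= t n.+1.
  elim: n => [|n [IH1 IH2]]; first by split => //; rewrite divfK ?gt_eqF.
  have tn1 : 0 < t n.+1 by apply: lt_le_trans IH2; rewrite mulr_gt0.
  split => //; rewrite -(ler_pM2l IH1); apply: le_trans (tc n).
  by rewrite mulrCA mulrA expr2 ler_pM2r.
have tg n : r ^+ n * t 0%N <= t n.
  elim: n => [|n IH]; first by rewrite expr0 mul1r.
  by apply: le_trans (tr n).2; rewrite exprS -mulrA ler_pM2l.
have [C hC] := td (r / 2) (divr_gt0 r0 (ltr0Sn _ 1)).
have [n /(_ n (leqnn _))] := half_pow_lt C t0_gt0.
rewrite ltNge => /negP; apply; rewrite -(ler_pM2l (exprn_gt0 n r0)).
by apply: le_trans (tg n) _; rewrite mulrCA -exprMn.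
Qed.

(* G = S + p <., q> is the inverse of a self-adjoint extension of the Jacobi
   operator.  On vectors orthogonal to all S^j p it is adjoint to S, so there it
   is symmetric and quasinilpotent, hence zero. *)
Lemma orthogonal_krylov_eq0 f : (forall j, inner (iter j S p) f = 0) -> f = 0.
Proof.
move=> fp; pose G f := S f + inner f q *: p.
pose K := [set f | forall j, inner (iter j S p) f = 0].
have innerDr (x y z : E) : inner x (y + z) = inner x y + inner x z by exact: linearDr.
have SG x g : K g -> inner (S x) g = inner x (G g).
  move=> Kg; have := sinv_green x g.
  rewrite (Kg 0%N) mulr0 subr0 => /eqP; rewrite subr_eq => /eqP ->.
  by rewrite /G innerDr linearZr_LR /= -innerC addrC [X in _ + X]mulrC.
have KG g : K g -> K (G g) by move=> Kg j; rewrite -SG // -iterS.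
have Kn n : K (iter n G f) by elim: n => // n IH; rewrite iterS; apply: KG.
have SnG n x : inner (iter n S x) f = inner x (iter n G f).
  elim: n x => // n IH x; rewrite iterSr IH iterS; exact: SG.
have Gsym x g : K g -> inner (G x) g = inner x (G g).
  move=> Kg; rewrite -SG // /G linearDl linearZl_LR /=.
  by rewrite (Kg 0%N) mulr0 addr0.
pose t n := rnorm (iter n G f).
have tt n : (t n ^+ 2)%:C = inner (iter n G f) (iter n G f) by rewrite inner_rnorm.
(* Symmetry of [G] and Cauchy-Schwarz give log-convexity of [t]; the identity between [t n ^+ 2] and
   the inner product of [S^n (G^n f)] with [f] transfers the decay from [S] to [G]. *)
have t1 : t 1%N = 0.
  apply: logconvex_eq0 => [n|n|eps e0]; first exact: rnorm_ge0.
    rewrite -[t n.+1 ^+ 2]normc_real ?sqr_ge0 // tt iterS Gsym; last exact: (Kn n.+1).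
    rewrite -!iterS; exact: inner_CS.
  have [C C0 hC] := sinv_quasinilpotent e0.
  exists (C * rnorm f) => n; have [tn|tn] := eqVneq (t n) 0.
    by rewrite tn !mulr_ge0 ?rnorm_ge0 ?exprn_ge0 ?(ltW e0).
  have tn0 : 0 < t n by rewrite lt_def tn rnorm_ge0.
  rewrite -(ler_pM2l tn0) -expr2 -[t n ^+ 2]normc_real ?sqr_ge0 // tt -SnG.
  apply: le_trans (inner_CS hE _ _) _.
  apply: le_trans (ler_wpM2r (rnorm_ge0 _) (hC _ _ tn0 (lexx _) n)) _.
  by rewrite le_eqVlt; apply/orP; left; apply/eqP; ring.
have /rnorm_eq0 /= Gf : rnorm (G f) = 0 := t1.
apply: (fourier_inj hE b_total).
have <- : jp 1 (G f) = cf f.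
  apply/funext => n; rewrite /G addrC jpow_lin /= /jpow /=.
  rewrite jacobi_psol mulr0 add0r.
  by rewrite jacobi_sinv.
by rewrite Gf jpow0; apply/funext => n; rewrite /fourier linear0l.
Qed.

(** [gen_kernel] is a subspace containing every [S^j p], so only 0 is orthogonal to it. *)
Lemma gen_kernel_dense x (eps : R) : 0 < eps ->
  exists2 y, gen_kernel y & rnorm (x - y) < eps.
Proof.
apply: (dense_of_orthogonal hE) => [|c y z [m hm] [n hn]|f hf].
- by exists 0%N; rewrite jpow0.
- exists (maxn m n); apply/funext => k; rewrite jpow_lin.
  rewrite (gen_kernel_le (leq_maxl m n) hm) (gen_kernel_le (leq_maxr m n) hn).
  by rewrite mulr0 addr0.
apply: orthogonal_krylov_eq0 => j; apply: hf; exists j.+1.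
rewrite jpow_sinv_ge // subSnn /jpow /=.
exact: jacobi_psol.
Qed.

Lemma periodic_dense x (eps : R) : 0 < eps ->
  exists m y, [/\ (1 <= m)%N, jp m y = cf y & rnorm (x - y) < eps].
Proof.
move=> e0; have [y [m hm] xy] := gen_kernel_dense x (divr_gt0 e0 (ltr0Sn _ 1)).
have h0 : 0 < 2^-1 :> R by rewrite invr_gt0.
have [C C0 hC] := sinv_quasinilpotent h0.
(* Adding 1 keeps [M] positive also for [y = 0]. *)
pose M := 1 + rnorm y; have M0 : 0 < M by rewrite ltr_pwDl ?rnorm_ge0.
have yM : rnorm y <= M by rewrite lerDr.
have [N hN] := half_pow_lt (2 * (C * M)) (divr_gt0 e0 (ltr0Sn _ 1)).
(* [m <= L] makes the [L]-th formal power annihilate [y]; [N <= L] makes the rest of the series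
   smaller than [eps / 2]. *)
have [L [L0 mL NL]] : exists L, [/\ (0 < L)%N, (m <= L)%N & (N <= L)%N].
  by exists (maxn m N).+1; split => //; rewrite leqW // ?leq_maxl ?leq_maxr.
have hL := gen_kernel_le mL hm.
pose X k := \sum_(i < k) iter (i * L)%N S y.
have XS k : X k.+1 = X k + iter (k * L)%N S y by rewrite /X big_ord_recr.
have SX k : rnorm (iter (k.+1 * L) S y) <= C * M * 2^-1 ^+ L * 2^-1 ^+ k.
  apply: le_trans (hC _ _ M0 yM _) _; rewrite mulrAC -!mulrA -exprD.
  rewrite !ler_wpM2l ?(ltW M0) // ler_wiXn2l ?invr_ge0 ?invf_le1 ?ler1n //.
  by rewrite mulSn leq_add2l leq_pmulr.
(* Starting at [X 1 = y] makes the tail bound at index 0 an estimate of the distance from [z] to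
   [y]. *)
have [|z Xz hz] := @rlim_geometric _ _ (fun k => X k.+1) (C * M * 2^-1 ^+ L).
  by move=> k; rewrite XS addrC addKr; exact: SX.
exists L, z; split => //.
  apply: (jpow_rlim (k0 := 1%N) Xz Xz) => k.
  apply/funext => n; rewrite add1n /X jpow_sum big_ord_recl mul0n /= hL add0r.
  rewrite -[RHS]/(jp 0 _ n) jpow_sum; apply: eq_bigr => i _.
  rewrite /= /bump /= add1n jpow_sinv_le ?mulSn ?leq_addr // addKn //.
have := hz 0%N; rewrite /X big_ord1 mul0n /= expr0 mulr1 => zy.
apply: le_lt_trans (ler_rnorm_dist y _ _) _; rewrite [eps]splitr ltrD //.
rewrite rnormB; apply: le_lt_trans zy _.
by rewrite mulrA; exact: hN.
Qed.

Lemma sinv_cvg0 y k : gen_kernel y -> exists N, [/\ (1 <= N)%N,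
  forall i, (N <= i)%N -> jp i y = fun=> 0 &
  forall i, (N <= i)%N -> rnorm (iter i S y) <= 2^-1 ^+ k].
Proof.
move=> [m hm]; have h0 : 0 < 2^-1 :> R by rewrite invr_gt0.
have [C C0 hC] := sinv_quasinilpotent h0.
pose M := 1 + rnorm y; have M0 : 0 < M by rewrite ltr_pwDl ?rnorm_ge0.
have yM : rnorm y <= M by rewrite lerDr.
have k0 : 0 < 2^-1 ^+ k :> R by rewrite exprn_gt0 // invr_gt0.
have [N hN] := half_pow_lt (C * M) k0.
exists (maxn m N).+1; split => // i hi.
  by apply: gen_kernel_le hm; rewrite (leq_trans (leq_maxl m N)) // ltnW.
apply: le_trans (hC _ _ M0 yM _) _; rewrite mulrAC ltW // hN //.
by rewrite (leq_trans (leq_maxr m N)) // ltnW.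
Qed.

(* Index k stands for the rational combination whose code is the 2-adic valuation
   of k + 1, so that every combination is listed infinitely often. *)
Lemma countable_dense : exists d : nat -> E, forall x (eps : R) n, 0 < eps ->
  exists2 k, (n <= k)%N & rnorm (x - d k) < eps.
Proof.
pose rc (r : rat * rat) : R[i] := (ratr r.1 +i* ratr r.2)%C.
pose d (t : seq (rat * rat)) : E := \sum_(k < size t) rc (nth (0, 0) t k) *: b k.
exists (fun k => d (odflt [::] (unpickle (logn 2 k.+1)))) => x eps n e0.
have e2 := divr_gt0 e0 (ltr0Sn _ 1).
have [N [c hc]] := b_total x e2.
have dl : 0 < eps / 2 / 2 / N.+1%:R by rewrite !divr_gt0.
have /choice[r hr] : forall k, exists r, nc (c k - rc r) < eps / 2 / N.+1%:R.
  move=> k; case: (c k) => c1 c2.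
  have rat_near (z : R) : exists r : rat, `|z - ratr r| < eps / 2 / 2 / N.+1%:R.
    have zl : z - eps / 2 / 2 / N.+1%:R < z by rewrite ltrBlDr ltrDl.
    have [r] := rat_in_itvoo zl.
    rewrite in_itv /= => /andP[h1 h2]; exists r.
    by rewrite ger0_norm ?subr_ge0 ?(ltW h2) // ltrBlDr addrC -ltrBlDr.
  have [[r1 h1] [r2 h2]] := (rat_near c1, rat_near c2).
  exists (r1, r2).
  rewrite (_ : _ - _ = (c1 - ratr r1) +i* (c2 - ratr r2)) //.
  apply: le_lt_trans (normc_le _ _) _.
  have -> : eps / 2 / N.+1%:R = eps / 2 / 2 / N.+1%:R + eps / 2 / 2 / N.+1%:R.
    by rewrite -mulrDl -splitr.
  by rewrite ltrD.
pose t := mkseq r N.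
exists ((2 ^ pickle t * n.*2.+1).-1)%N.
  rewrite -ltnS prednK ?muln_gt0 ?expn_gt0 //.
  by rewrite (leq_trans _ (leq_pmull _ _)) ?expn_gt0 // ltnS -addnn leq_addr.
rewrite prednK ?muln_gt0 ?expn_gt0 // lognM ?expn_gt0 // pfactorK //.
rewrite (logn_coprime (m := n.*2.+1)); last by rewrite coprime2n /= odd_double.
rewrite addn0 pickleK.
apply: le_lt_trans (ler_rnorm_dist (\sum_(k < N) c k *: b k) _ _) _.
rewrite [eps]splitr ltrD // /d size_mkseq -sumrB.
apply: le_lt_trans (ler_rnorm_sum _) _.
apply: le_lt_trans (_ : \sum_(k < N) (eps / 2 / N.+1%:R) < _).
  rewrite ler_sum // => k _; rewrite nth_mkseq // -scalerBl rnormZ.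
  by rewrite (rnorm_basis hE b_orthonormal) mulr1 ltW.
rewrite sumr_const card_ord -[ltLHS]mulr_natr mulrAC ltr_pdivrMr //.
by rewrite ltr_pM2l // ltr_nat.
Qed.

(** The first property will place [x] in the domain of every power through [l2_jpow_le], the second
    makes its orbit dense. *)
Lemma hypercyclic_vector : exists x,
  (forall m, exists n z, (m <= n)%N /\ jp n x = cf z) /\
  forall z (eps : R), 0 < eps -> exists n y, jp n x = cf y /\ rnorm (z - y) < eps.
Proof.
have [d hd] := countable_dense.
have h2 n : 0 < 2^-1 ^+ n :> R by rewrite exprn_gt0 // invr_gt0.
have /choice[y hy] : forall k, exists y, gen_kernel y /\ rnorm (d k - y) < 2^-1 ^+ k.
  by move=> k; have [y] := gen_kernel_dense (d k) (h2 k); exists y.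
have /choice[N hN] := fun k => sinv_cvg0 k (hy k).1.
(* In the gap after [n k], the part [N k] lets later powers annihilate the term of [y k]; the part
   [N k.+1] keeps the term of [y k.+1] small under all earlier powers. *)
have [n n0 nS] : exists2 n : nat -> nat, n 0%N = N 0%N &
    forall k, n k.+1 = (n k + (N k + N k.+1))%N.
  by exists (fix n k := if k is l.+1 then (n l + (N l + N l.+1))%N else N 0%N).
have n_gap j l : (n j + (N j + N (j + l).+1) <= n (j + l).+1)%N.
  elim: l => [|l IH]; first by rewrite addn0 nS.
  by move: IH; rewrite addnS (nS (j + l).+1); lia.
have n_ge k : (k < n k)%N.
  elim: k => [|k IH]; first by rewrite n0; case: (hN 0%N).
  by rewrite nS; have [] := hN k; lia.
have N_le k : (N k <= n k)%N by case: k => [|k]; rewrite ?n0 ?nS //; lia.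
pose X k := \sum_(i < k) iter (n i) S (y i).
have XS k : X k.+1 = X k + iter (n k) S (y k) by rewrite /X big_ord_recr.
have [|x Xx _] := @rlim_geometric _ _ X 1.
  move=> k; rewrite XS addrC addKr mul1r.
  by have [_ _] := hN k; apply.
have hX j : exists2 z, jp (n j) x = cf z & rnorm (z - y j) <= 2^-1 ^+ j.
  (* The image of the series under the power [n j]: terms before [j] vanish, term [j] becomes [y j],
     later ones keep [n (j + l).+1 - n j] factors [S]. *)
  pose Z k := y j + \sum_(l < k) iter (n (j + l).+1 - n j) S (y (j + l).+1).
  have ZS k : Z k.+1 = Z k + iter (n (j + k).+1 - n j) S (y (j + k).+1).
    by rewrite /Z big_ord_recr addrA.
  have [|z Zz hz] := @rlim_geometric _ _ Z (2^-1 ^+ j.+1).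
    move=> k; rewrite ZS addrC addKr -exprD.
    have [_ _ hNk] := hN (j + k).+1; rewrite addSn; apply: hNk.
    by have := n_gap j k; lia.
  exists z; last first.
    have := hz 0%N; rewrite /Z big_ord0 addr0 expr0 mulr1 exprS mulrA divff ?pnatr_eq0 //.
    by rewrite mul1r.
  apply: (jpow_rlim (k0 := j.+1) Xx Zz); elim=> [|k IH]; apply/funext => i.
    rewrite addn0 /X jpow_sum big_ord_recr /= big1 => [|[l lj] _ /=].
      by rewrite add0r jpow_sinv_le // subnn /Z big_ord0 addr0.
    have := n_gap l (j - l.+1)%N; rewrite -addSn subnKC // => g.
    have [_ hNl _] := hN l.
    by rewrite jpow_sinv_ge ?hNl //; lia.
  rewrite addnS XS jpowD IH addSn.
  rewrite jpow_sinv_le; last by have := n_gap j k; lia.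
  by rewrite -fourierD ZS.
exists x; split => [m|z eps e0].
  by have [z hz _] := hX m; exists (n m), z; rewrite ltnW.
have e3 : 0 < eps / 3 by rewrite divr_gt0.
have [j0 hj0] := half_pow_lt 1 e3.
(* [d] comes close to [z] at arbitrarily large indices, so [j] can be so large that the distances
   from [d j] to [y j] and from [y j] to [u] are also below [eps / 3]. *)
have [j jj0 hj] := hd z _ j0 e3; have [u hu huy] := hX j.
exists (n j), u; split => //.
apply: le_lt_trans (ler_rnorm_dist (d j) _ _) _.
have := hj0 _ jj0; have := (hy j).2.
have := ler_rnorm_dist (y j) (d j) u; rewrite (rnormB (y j) u).
lra.
Qed.

(** * From coefficient identities to the operator [H] *)

Section Operator.
Variable H : operator E.
Hypothesis H_dom : forall x, dom H x <-> l2 (jacobi v (cf x)).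
Hypothesis H_fourier : forall x, dom H x -> cf (H x) = jacobi v (cf x).

Let fourier_injE := fourier_inj hE b_total.

(** Square-summability of the top formal power descends to all lower ones by [l2_jpow_le], so the
    recursively defined domain is as large as it can be. *)
Lemma op_powP m x : (dom (op_pow H m) x <-> l2 (jp m x)) /\
  (dom (op_pow H m) x -> cf (op_pow H m x) = jp m x).
Proof.
elim: m x => [|m IH] x /=.
  by split => //; split => // _; exact: (l2_fourier hE b_orthonormal).
have jpS : dom H x -> jp m (H x) = jp m.+1 x.
  by move=> hx; rewrite /jpow H_fourier // -iterSr.
split; last by move=> [hx hHx]; rewrite (IH _).2 // jpS.
split=> [[hx /(IH _).1]|hx]; first by rewrite jpS.
have dx : dom H x by apply/H_dom; exact: (@l2_jpow_le 1 m.+1 x isT hx).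
by split => //; apply/(IH _).1; rewrite jpS.
Qed.

Lemma dom_op_pow m x y : jp m x = cf y -> dom (op_pow H m) x /\ op_pow H m x = y.
Proof.
move=> xy; have [hd hc] := op_powP m x.
have dx : dom (op_pow H m) x by apply/hd; rewrite xy; exact: (l2_fourier hE b_orthonormal).
by split => //; apply: fourier_injE; rewrite hc.
Qed.

Lemma op_pow_closed m : closed_operator (op_pow H m).
Proof.
apply: closed_rnorm2 => x y hxy.
have [|d1 <-] := @dom_op_pow m x y; last by split.
apply: jpow_closed => eps /hxy[x' [y' [[/= d1 ->] h1 h2]]].
by exists x', (op_pow H m x'); rewrite (op_powP m x').2.
Qed.

Lemma op_hypercyclic : hypercyclic H.
Proof.
have [x [hx1 hx2]] := hypercyclic_vector; exists x.
  move=> m _; have [n [z [mn xz]]] := hx1 m.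
  apply/(op_powP m x).1; apply: (l2_jpow_le mn); rewrite xz.
  exact: (l2_fourier hE b_orthonormal).
apply/dense_rnorm => z eps /(hx2 z)[n [y [xy zy]]].
by exists y => //; exists n => //; have [] := dom_op_pow xy.
Qed.

Lemma op_periodic_dense : dense (periodic_points H).
Proof.
apply/dense_rnorm => z eps /(periodic_dense z)[m [y [m1 yy zy]]].
by exists y => //; exists m; have [] := dom_op_pow yy.
Qed.

(** Periodic points lie in the domain, because a period is at least 1. *)
Lemma op_densely_defined : densely_defined H.
Proof.
apply/dense_rnorm => z eps e0.
have /dense_rnorm/(_ z eps e0)[y [[|m] [//= _ [dy _] _]] zy] := op_periodic_dense.
by exists y.
Qed.

Lemma op_linear : linear_operator H.
Proof.
split.
  apply/H_dom; have -> : jacobi v (cf 0) = cf 0.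
    by rewrite -[LHS]/(jp 1 0) jpow0; apply/funext => n; rewrite /fourier linear0l.
  exact: (l2_fourier hE b_orthonormal).
move=> c x y dx dy; have [] := @dom_op_pow 1 (c *: x + y) (c *: H x + H y).
  apply/funext => n; rewrite jpow_lin fourierD fourierZ !H_fourier //.
by move=> [? _].
Qed.

Definition eigenvector (z : R[i]) : E := vec b (jsol v z (fun=> 0) 1).

Lemma l2_jsol_homogeneous (z : R[i]) : l2 (jsol v z (fun=> 0) 1).
Proof.
apply: (jacobi_l2 v_gt0 sum_v v_logconcave (z := z) (y := fun=> 0)).
  by exists 0 => n; rewrite big1 // => k _; rewrite Normc.normc0 expr0n.
exact: jacobi_jsol.
Qed.

Lemma op_eigenvector (z : R[i]) :
  [/\ dom H (eigenvector z), H (eigenvector z) = z *: eigenvector z & eigenvector z != 0].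
Proof.
have cu : cf (eigenvector z) = jsol v z (fun=> 0) 1.
  by rewrite (fourier_vec hE b_orthonormal) //; exact: l2_jsol_homogeneous.
have [] := @dom_op_pow 1 (eigenvector z) (z *: eigenvector z).
  apply/funext => n; rewrite fourierZ /jpow /= cu jacobi_jsol // addr0 //.
move=> [du _] Hu; split => //; apply/eqP => u0.
have := congr1 (@^~ 0%N) cu; rewrite u0 /= /fourier linear0l => /esym/eqP.
by rewrite oner_eq0.
Qed.

(** Both 0 and an eigenvector for [z] solve [H x - z *: x = 0], against uniqueness in the resolvent
    set. *)
Lemma op_spectrum : spectrum H = [set: R[i]].
Proof.
apply/seteqP; split => // z _ [hz _].
have [x [_ ux]] := hz 0; have [du Hu /eqP] := op_eigenvector z; apply.
have l0 := op_linear.1.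
have H0 : H 0 = 0.
  by have [_ hl] := op_linear; have := (hl (-1) _ _ l0 l0).2; rewrite scaler0 addr0 scaleN1r addNr.
rewrite -(ux 0); last by rewrite H0 scaler0 subrr.
by apply/esym/ux; rewrite Hu subrr.
Qed.

(** A bound [M] is violated by an eigenvector for the eigenvalue [|M| + 1]. *)
Lemma op_unbounded : ~ bounded_operator H.
Proof.
move=> [M hM]; have [du Hu u0] := op_eigenvector (`|M| + 1)%:C.
have := hM _ du; rewrite Hu normrZ ler_pM2r ?normr_gt0 //.
rewrite normr_normc normc_real ?addr_ge0 // lecR => h.
by have := ler_norm M; lra.
Qed.

Lemma op_chaotic : chaotic H.
Proof.
split.
  by split; [exact: op_linear | exact: op_unbounded | exact: op_densely_defined].
split; [|exact: op_hypercyclic|exact: op_periodic_dense].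
by move=> n _; exact: op_pow_closed.
Qed.

End Operator.

End JacobiDynamics.

(** * Extended-real series and the passage to indices from 1 *)

Lemma nneseries_lt_pinftyP (R : realType) (f : nat -> R) :
  (forall n, (1 <= n)%N -> 0 <= f n) ->
  (\sum_(1 <= n <oo) (f n)%:E < +oo)%E <->
  exists M : R, forall N, \sum_(k < N) f k.+1 <= M.
Proof.
move=> f0; have f0E n : (1 <= n)%N -> true -> (0 <= (f n)%:E)%E.
  by move=> n1 _; rewrite lee_fin f0.
have sE N : \sum_(k < N) f k.+1 = \sum_(1 <= n < N.+1) f n.
  by rewrite big_add1 big_mkord.
split=> [fin|[M hM]].
  have s0 : (0 <= \sum_(1 <= n <oo) (f n)%:E)%E by exact: nneseries_ge0.
  exists (fine (\sum_(1 <= n <oo) (f n)%:E)%E) => N.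
  rewrite -lee_fin fineK ?ge0_fin_numE // sE -sumEFin.
  exact: nneseries_lim_ge.
apply: le_lt_trans (ltry M); apply: lime_le; first exact: is_cvg_nneseries.
apply: nearW => -[|N].
  rewrite big_geq // lee_fin; by have := hM 0%N; rewrite big_ord0.
by rewrite sumEFin lee_fin -sE.
Qed.

Lemma square_summableP (R : realType) (c : nat -> R[i]) :
  square_summable c <-> l2 (fun n => c n.+1).
Proof.
by apply: (nneseries_lt_pinftyP (f := fun n => nc (c n) ^+ 2)) => n _; exact: sqr_ge0.
Qed.

Theorem theorem3p1 (R : realType) (E : completeNormedModType R[i])
    (inner : {dot E for Num.conj}) (e : nat -> E) (w : nat -> R)
    (T : operator E)
    (hE : hilbert_norm inner)
    (he : orthonormal_basis inner e)
    (hw : forall n, (1 <= n)%N -> 0 < w n)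
    (hT : same_operator T (backward_shift inner e w))
    (hTc : chaotic T)
    (hTadj : forall n, (1 <= n)%N ->
       dom (adjoint inner T) (e n) /\
       adjoint inner T (e n) = (w n)%:C *: e n.+1)
    (hyp1 : (\sum_(1 <= n <oo) ((w n)^-1)%:E < +oo)%E)
    (hyp2 : forall n, (2 <= n)%N -> w n.-1 * w n.+1 <= w n ^+ 2)
    (hyp3 : exists (alpha beta a : R) (gamma : nat -> R),
       [/\ 0 < alpha, 0 < beta, 0 < a &
           forall n, (1 <= n)%N -> gamma n != 0] /\
       [/\ forall n, (1 <= n)%N ->
             n%:R `^ (1 + alpha) <= w n * gamma n / gamma n.+1,
           (fun n : nat => (w n.-1 * gamma n.+1) / (w n * gamma n.-1)
                           - (1 - a / n%:R) : R^o)
             =O_\oo (fun n : nat => (n%:R `^ (1 + beta))^-1 : R^o) &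
           (\sum_(1 <= n <oo) ((gamma n ^+ 2)^-1)%:E < +oo)%E]) :
  let H := shift_plus_adjoint inner e w in
  (forall z : R[i], exists u : nat -> R[i], solves_recurrence w z u) /\
  (forall (z : R[i]) (u : nat -> R[i]), solves_recurrence w z u ->
     square_summable u) /\
  spectrum H = [set: R[i]] /\
  (forall m : nat, closed_operator (op_pow H m)) /\
  hypercyclic H /\
  chaotic H.
Proof.
(* After this shift the values of [w] and [e] at index 0 no longer enter. *)
move=> H; pose v n := w n.+1; pose b n := e n.+1.
have v_gt0 n : 0 < v n by exact: hw.
have [V sum_v] : exists V : R, forall n, \sum_(k < n) (v k)^-1 <= V.
  apply/(nneseries_lt_pinftyP (f := fun n => (w n)^-1)) => // n n1.
  by rewrite invr_ge0 ltW // hw.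
have v_lc n : v n * v n.+2 <= v n.+1 ^+ 2 by exact: (hyp2 n.+2).
have b_on m n : inner (b m) (b n) = (m == n)%:R by rewrite he.1.
have b_total x (eps : R) : 0 < eps ->
    exists N (c : nat -> R[i]), rnorm (x - \sum_(k < N) c k *: b k) < eps.
  move/((dense_rnorm _).1 he.2 x) => [_ [N [c ->]] xc].
  exists N.-1, (fun k => c k.+1); move: xc; congr (rnorm (_ - _) < _).
  by rewrite big_add1 big_mkord.
have formalE x n : (w n.+1)%:C * inner x (e n.+2) +
    (if n.+1 == 1%N then 0 else (w n)%:C * inner x (e n)) =
    jacobi v (fourier inner b x) n by case: n.
have H_dom x : dom H x <-> l2 (jacobi v (fourier inner b x)).
  by rewrite -(funext (formalE x)); exact: square_summableP.
have H_fourier x : dom H x -> fourier inner b (H x) = jacobi v (fourier inner b x).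
  move=> /H_dom hx; rewrite -[RHS](fourier_vec hE b_on) //; congr fourier.
  apply: rlim_lim => eps e0; have [n0 hn0] := rlim_psum_vec hE b_on hx e0.
  (* A sum over indices from 1 up to but excluding [n.+1] has [n] terms, hence the successor. *)
  exists n0.+1 => -[//|n] /hn0; rewrite big_add1 big_mkord /psum.
  by under eq_bigr do rewrite -formalE.
have solE u z : solves_recurrence w z u ->
    forall n, jacobi v (fun k => u k.+1) n = z * u n.+1 + 0.
  move=> [u1 u2 hu] [|n]; rewrite /jacobi addr0; last by rewrite addrC (hu n.+2).
  by rewrite u2 u1 addr0 mulr1 mulrC divfK // (inj_eq (@complexI R)) gt_eqF ?hw.
split; [|split; [|split; [|split; [|split]]]].
(* The value at index 0 is unconstrained; [n.-1] merely repeats the first coefficient there. *)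
- move=> z; pose u := jsol v z (fun=> 0) 1; exists (fun n => u n.-1).
  split => [//||[|[|n]] // _]; first by rewrite /u /= mulr1 addr0 subr0.
  by have := jacobi_jsol z (fun=> 0) 1 v_gt0 n.+1; rewrite addr0 /= => <-; rewrite addrC.
- move=> z u /solE hu; apply/square_summableP.
  apply: (jacobi_l2 v_gt0 sum_v v_lc) hu.
  by exists 0 => n; rewrite big1 // => k _; rewrite Normc.normc0 expr0n.
- exact: (op_spectrum hE b_on b_total v_gt0 sum_v v_lc H_dom H_fourier).
- exact: (op_pow_closed hE b_on b_total v_gt0 sum_v v_lc H_dom H_fourier).
- exact: (op_hypercyclic hE b_on b_total v_gt0 sum_v v_lc H_dom H_fourier).
- exact: (op_chaotic hE b_on b_total v_gt0 sum_v v_lc H_dom H_fourier).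
Qed.
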